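(* Let $K$ be a field with $\operatorname{char}K\neq 2$ and let $n\geq 2$. Let $\operatorname{per}_n\in K[x_{ij}:1\le i,j\le n]$ be the permanent of the generic $n\times n$ matrix. Then \[ \operatorname{codim}_{\mathbb A^{n^2}}\operatorname{Crit}(\operatorname{per}_n)=2n . \] The same equality holds for the singular locus of the hypersurface $\{\operatorname{per}_n=0\}$, with codimension still measured in $\mathbb A^{n^2}$; that is, this singular locus has codimension $2n$ in $\mathbb A^{n^2}$.
   Context: The generic $n\times n$ permanent is $\operatorname{per}_n=\sum_{\sigma\in S_n}\prod_{i=1}^n x_{i\sigma(i)}$, where the $x_{ij}$ are independent variables. The critical locus $\operatorname{Crit}(\operatorname{per}_n)$ is the common zero locus in $\mathbb A^{n^2}$ (over an algebraic closure of $K$) of all partial derivatives $\partial \operatorname{per}_n/\partial x_{ij}$, $1\le i,j\le n$. The singular locus of $\{\operatorname{per}_n=0\}$ is the common zero locus of $\operatorname{per}_n$ and all of its partial derivatives. Codimension is measured in the full matrix space $\mathbb A^{n^2}$, not in the hypersurface. *)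

(* Defs.v *)
From HB Require Import structures.
From mathcomp Require Import all_boot all_order all_algebra all_fingroup.
From mathcomp Require Import boolp classical_sets.
From mathcomp Require Import mpoly.

Set Implicit Arguments.
Unset Strict Implicit.
Unset Printing Implicit Defensive.

Import GRing.Theory.
Local Open Scope classical_set_scope.
Local Open Scope ring_scope.

Section Permanent.

Definition permanent (R : comNzRingType) (n : nat) (A : 'M[R]_n) : R :=
  \sum_(s : 'S_n) \prod_(i < n) A i (s i).

(* The variable x_ij is the one of index [mxvec_index i j], so that a matrix
   [A] is the point [mxvec A] of affine (n * n)-space. *)
Definition generic_mx (R : comNzRingType) (n : nat) :
    'M[{mpoly R[n * n]}]_n :=
  \matrix_(i < n, j < n) 'X_(mxvec_index i j).

Definition per (R : comNzRingType) (n : nat) : {mpoly R[n * n]} :=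
  permanent (generic_mx R n).

End Permanent.

Section Zariski.

Variables (F : closedFieldType) (N : nat).
Implicit Types (Z Y A B : set 'rV[F]_N).

Definition zero_locus (S : set {mpoly F[N]}) : set 'rV[F]_N :=
  [set v : 'rV[F]_N | forall p : {mpoly F[N]}, S p -> p.@[v 0] = 0].

Definition zariski_closed Z : Prop := exists S, Z = zero_locus S.

Definition zariski_irreducible Z : Prop :=
  Z !=set0 /\
  forall A B, zariski_closed A -> zariski_closed B ->
    Z `<=` A `|` B -> Z `<=` A \/ Z `<=` B.

(* A chain Y_0 < Y_1 < ... < Y_k has length k. It is intended for closed [Z],
   whose relatively closed subsets are the closed sets contained in [Z]. *)
Definition irreducible_chain Z (k : nat) (Y : 'I_k.+1 -> set 'rV[F]_N) : Prop :=
  (forall i, [/\ zariski_closed (Y i), zariski_irreducible (Y i)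
               & Y i `<=` Z]) /\
  (forall i j : 'I_k.+1, (i < j)%N -> Y i `<` Y j).

Definition has_dim Z (d : nat) : Prop :=
  (exists Y : 'I_d.+1 -> set 'rV[F]_N, irreducible_chain Z Y) /\
  (forall k (Y : 'I_k.+1 -> set 'rV[F]_N), irreducible_chain Z Y -> (k <= d)%N).

Definition has_codim Z (c : nat) : Prop :=
  exists D d : nat, [/\ has_dim setT D, has_dim Z d & D = (d + c)%N].

End Zariski.

Section SingularLocus.

Variables (K : fieldType) (F : closedFieldType) (iota : {rmorphism K -> F}).
Variables (N : nat) (p : {mpoly K[N]}).

Definition crit_locus : set 'rV[F]_N :=
  [set v : 'rV[F]_N | forall i : 'I_N, (map_mpoly iota (p^`M(i))).@[v 0] = 0].

Definition sing_locus : set 'rV[F]_N :=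
  [set v : 'rV[F]_N | (map_mpoly iota p).@[v 0] = 0 /\ crit_locus v].

End SingularLocus.

Definition is_algebraic_closure (K : fieldType) (F : closedFieldType)
    (iota : {rmorphism K -> F}) : Prop :=
  forall x : F, algebraicOver iota x.

(* Main.v *)
(* Codimension of Crit(per_n). Let E(n) = F[e_1, ..., e_n] / (e_j ^ 2), so that
   the products of k linear forms of E(n) collect the k-subpermanents of their
   coefficients: a matrix is critical iff the products of all but one of its
   rows vanish. More generally, m <= n rows in E(n) all of whose (m - 1)-fold
   products vanish have codimension at least 2 n, by induction on n.

   At a generic point of a component, move a nonzero entry to the first column
   and scale it to 1: the pivot row is e + x with x in E(n - 1), the other rows
   are r_l + a_l e. With z_k, w_ik the products of the r_l omitting one or two
   of them and y_k = sum_i a_i w_ik, the equations give z_k + x y_k = 0, hence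
   x ^ 2 y_k = 0 and x (sum_i a_i y_i) = 0. Giving the r_l a larger weight, the
   dimension does not drop when the first equation is replaced by its leading
   form z_k = 0. The induction hypothesis then bounds the r_l; either all the
   w_ik vanish, which costs two more conditions on the r_l, or the last two
   equations are two independent conditions on (x, a). The latter is the only
   place where the characteristic matters.

   Codimensions are measured by transcendence degrees of points with
   coordinates in arbitrary field extensions. Conversely the matrices with two
   zero rows form a linear space of codimension 2 n in the singular locus. *)

Require Import Defs.
From HB Require Import structures.
From mathcomp Require Import all_boot all_order all_algebra all_fingroup.
From mathcomp Require Import boolp classical_sets.
From mathcomp Require Import mpoly.
From mathcomp Require Import ring zify.

Set Implicit Arguments.
Unset Strict Implicit.
Unset Printing Implicit Defensive.

Import GRing.Theory.
Local Open Scope ring_scope.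

(** * Algebraic closure inside a field *)

(** The equation z_k + x y_k = 0 does not make z_k vanish, so the induction hypothesis says nothing
    about the rows r_l of the critical matrix itself; this is why a degeneration is needed. The two
    products with x must be formed beforehand: the leading form of the first equation alone is z_k =
    0, which leaves x and a unconstrained. The degenerate point lives over a new field and is known
    only through its equations, so every bound is quantified over all extensions of K.

    Pivoting removes one row and one column, but the case where all w_ik vanish removes rows and
    keeps the columns; hence the number m of rows must vary independently of n. The condition m <= n
    keeps the degree of the products w_ik low enough: in degree n every linear form annihilates, and
    for m > n + 1 the (m - 1)-fold products vanish identically. In characteristic 2 the permanent is
    the determinant, whose critical locus has codimension 4 for every n. *)

Inductive rcl (R : nzRingType) (B : R -> Prop) : R -> Prop :=
| rcl_in x of B x : rcl B x
| rcl1 : rcl B 1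
| rclB x y of rcl B x & rcl B y : rcl B (x - y)
| rclM x y of rcl B x & rcl B y : rcl B (x * y).

(** All field operations are constructors, so membership of an explicit expression follows its
    shape; [acl_alg] recovers a polynomial relation. *)
Inductive acl (F : fieldType) (B : F -> Prop) : F -> Prop :=
| acl_in x of B x : acl B x
| acl1 : acl B 1
| aclB x y of acl B x & acl B y : acl B (x - y)
| aclM x y of acl B x & acl B y : acl B (x * y)
| aclV x of acl B x : acl B x^-1
| acl_root (p : {poly F}) x of p != 0 & (forall i, acl B p`_i) & root p x :
    acl B x.

Section RingClosure.
Variables (R : nzRingType).
Implicit Types (B : R -> Prop).

Lemma rcl0 B : rcl B 0.
Proof. by rewrite -(subrr 1); apply: rclB; apply: rcl1. Qed.

Lemma rclN B x : rcl B x -> rcl B (- x).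
Proof. by move=> Bx; rewrite -sub0r; apply: rclB => //; apply: rcl0. Qed.

Lemma rclD B x y : rcl B x -> rcl B y -> rcl B (x + y).
Proof. by move=> Bx By; rewrite -(opprK y); apply: rclB => //; apply: rclN. Qed.

Lemma rcl_map (S : nzRingType) (f : {rmorphism R -> S}) B y :
  rcl (fun z => exists2 x, B x & z = f x) y -> exists2 x, rcl B x & y = f x.
Proof.
elim=> {y}[_ [x Bx ->]||_ _ _ [x Bx ->] _ [y By ->]|_ _ _ [x Bx ->] _ [y By ->]].
- by exists x => //; apply: rcl_in.
- by exists 1; [apply: rcl1 | rewrite rmorph1].
- by exists (x - y); [apply: rclB | rewrite rmorphB].
- by exists (x * y); [apply: rclM | rewrite rmorphM].
Qed.

End RingClosure.

Section FractionClosure.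
Variables (F : fieldType) (B : F -> Prop).

(** The fraction field of [rcl B] is realised inside [F], so that the closure properties of
    [algebraicOver] yield [acl_alg]. *)
Definition fcl : {pred F} := fun z =>
  `[< exists a b, [/\ rcl B a, rcl B b, b != 0 & z = a / b] >].

Fact fcl_divring : divring_closed fcl.
Proof.
split.
- by apply/asboolP; exists 1, 1; rewrite divr1 oner_neq0; split=> //; apply: rcl1.
- move=> x y /asboolP[a [b [Ba Bb b0 ->]]] /asboolP[c [d [Bc Bd d0 ->]]].
  apply/asboolP; exists (a * d - c * b), (b * d); split.
  + by apply: rclB; apply: rclM.
  + exact: rclM.
  + exact: mulf_neq0.
  + by field; rewrite b0 d0.
- move=> x y /asboolP[a [b [Ba Bb b0 ->]]] /asboolP[c [d [Bc Bd d0 ->]]].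
  have [->|c0] := eqVneq c 0.
    apply/asboolP; exists 0, 1; split; [exact: rcl0|exact: rcl1|exact: oner_neq0|].
    by rewrite mul0r invr0 mulr0 mul0r.
  apply/asboolP; exists (a * d), (b * c); split; rewrite ?mulf_neq0 //.
  + exact: rclM.
  + exact: rclM.
  + by field; rewrite b0 d0 c0.
Qed.

HB.instance Definition _ := GRing.isDivringClosed.Build F fcl fcl_divring.

Record frac_closure := FracClosure { fcl_val : F; _ : fcl_val \in fcl }.

HB.instance Definition _ := [isSub for fcl_val].
HB.instance Definition _ := [Choice of frac_closure by <:].
HB.instance Definition _ := [SubChoice_isSubIntegralDomain of frac_closure by <:].
HB.instance Definition _ := [SubIntegralDomain_isSubField of frac_closure by <:].

Lemma clear_denominators (p : {poly frac_closure}) :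
  exists b, [/\ rcl B b, b != 0 & forall i, rcl B (b * val p`_i)].
Proof.
elim/poly_ind: p => [|p c [b [Bb b0 IH]]].
  exists 1; split; [exact: rcl1|exact: oner_neq0|move=> i].
  by rewrite coef0 rmorph0 mulr0; apply: rcl0.
case: c => c cP; have /asboolP[a [d [Ba Bd d0 cE]]] := cP.
exists (b * d); split; [exact: rclM|exact: mulf_neq0|move=> i].
rewrite coefD coefMX coefC; case: i => [|i] /=.
  rewrite add0r; suff E : b * d * c = b * a by rewrite [X in rcl _ X]E; apply: rclM.
  by rewrite cE -mulrA [d * _]mulrC divfK.
by rewrite addr0 mulrAC; apply: rclM.
Qed.

Lemma acl_alg z : acl B z ->
  exists p : {poly F}, [/\ p != 0, forall i, rcl B p`_i & root p z].
Proof.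
move=> Bz; suff [p p0 pz] : algebraicOver (val : frac_closure -> F) z.
  have [b [Bb b0 bP]] := clear_denominators p.
  pose f : {rmorphism frac_closure -> F} := val.
  exists (b *: map_poly f p); split.
  - by rewrite scaler_eq0 negb_or b0 map_poly_eq0.
  - by move=> i; rewrite coefZ coef_map; apply: bP.
  - by rewrite rootE hornerZ (rootP pz) mulr0.
elim: Bz => {z}[x Bx||x y _ IHx _ IHy|x y _ IHx _ IHy|x _ IHx|p x p0 _ IHp px].
- have xf : x \in fcl.
    apply/asboolP; exists x, 1; rewrite divr1 oner_neq0; split=> //.
    + exact: rcl_in.
    + exact: rcl1.
  exact: (algebraic_id _ (FracClosure xf)).
- exact: algebraic1.
- exact: algebraic_sub.
- exact: algebraic_mul.
- exact: algebraic_inv.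
- apply/integral_algebraic; apply: (integral_root p0 px) => y /(nthP 0)[i _ <-].
  exact/integral_algebraic.
Qed.

End FractionClosure.

Section AlgebraicClosure.
Variables (F : fieldType).
Implicit Types (B : F -> Prop) (s t : seq F).

Definition addb B s : F -> Prop := fun x => B x \/ x \in s.

Lemma acl0 B : acl B 0.
Proof. by rewrite -(subrr 1); apply: aclB; apply: acl1. Qed.

Lemma aclN B x : acl B x -> acl B (- x).
Proof. by move=> Bx; rewrite -sub0r; apply: aclB => //; apply: acl0. Qed.

Lemma aclD B x y : acl B x -> acl B y -> acl B (x + y).
Proof. by move=> Bx By; rewrite -(opprK y); apply: aclB => //; apply: aclN. Qed.

Lemma acl_sum B (I : Type) (r : seq I) (P : pred I) (f : I -> F) :
  (forall i, P i -> acl B (f i)) -> acl B (\sum_(i <- r | P i) f i).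
Proof. by move=> Bf; apply: big_ind => //; [apply: acl0 | apply: aclD]. Qed.

Lemma aclX B x k : acl B x -> acl B (x ^+ k).
Proof.
move=> Bx; elim: k => [|k IH]; first by rewrite expr0; apply: acl1.
by rewrite exprS; apply: aclM.
Qed.

Lemma acl_prod B (I : Type) (r : seq I) (P : pred I) (f : I -> F) :
  (forall i, P i -> acl B (f i)) -> acl B (\prod_(i <- r | P i) f i).
Proof. by move=> Bf; apply: big_ind => //; [apply: acl1 | apply: aclM]. Qed.

Lemma acl_trans B B' z : (forall x, B x -> acl B' x) -> acl B z -> acl B' z.
Proof.
move=> BB'; elim=> {z}[x /BB'//||x y _ ? _ ?|x y _ ? _ ?|x _ ?|p x p0 _ Bp px].
- exact: acl1.
- exact: aclB.
- exact: aclM.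
- exact: aclV.
- exact: acl_root p0 Bp px.
Qed.

Lemma acl_addb B s x : acl B x -> acl (addb B s) x.
Proof. by apply: acl_trans => y By; apply: acl_in; left. Qed.

Lemma acl_mem B s x : x \in s -> acl (addb B s) x.
Proof. by move=> xs; apply: acl_in; right. Qed.

Lemma acl_addb_sub B s t x :
  {subset s <= t} -> acl (addb B s) x -> acl (addb B t) x.
Proof.
move=> st; apply: acl_trans => y [By|ys]; apply: acl_in; [by left|right].
exact: st.
Qed.

Lemma rcl_adjoin B y z :
  rcl (addb (acl B) [:: y]) z ->
  exists2 q : {poly F}, (forall i, acl B q`_i) & z = q.[y].
Proof.
elim=> {z}[x [Bx|]||_ _ _ [p Bp ->] _ [q Bq ->]|_ _ _ [p Bp ->] _ [q Bq ->]].
- exists x%:P; last by rewrite hornerC.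
  by move=> i; rewrite coefC; case: ifP => // _; apply: acl0.
- rewrite inE => /eqP->; exists 'X; last by rewrite hornerX.
  by move=> i; rewrite coefX; case: eqP => _; [apply: acl1 | apply: acl0].
- exists 1; last by rewrite hornerC.
  by move=> i; rewrite coef1; case: eqP => _; [apply: acl1 | apply: acl0].
- exists (p - q); last by rewrite !hornerE.
  by move=> i; rewrite coefB; apply: aclB.
- exists (p * q); last by rewrite hornerM.
  by move=> i; rewrite coefM; apply: acl_sum => j _; apply: aclM.
Qed.

Lemma acl_exchange B x y :
  acl (addb B [:: y]) x -> ~ acl B x -> acl (addb B [:: x]) y.
Proof.
move=> Bx nBx.
have {Bx} : acl (addb (acl B) [:: y]) x.
  apply: acl_trans Bx => z [Bz|zy]; apply: acl_in; [left; exact: acl_in|by right].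
case/acl_alg=> p [p0 pB /rootP px].
have /choice[q qP] i : exists q : {poly F}, (forall j, acl B q`_j) /\ p`_i = q.[y].
  by have [q ? ?] := rcl_adjoin (pB i); exists q.
(* The same relation read as a polynomial in [y], with coefficients depending on [x]. *)
pose d := \sum_(i < size p) q i * (x ^+ i)%:P.
have dE j : d`_j = \sum_(i < size p) (q i)`_j * x ^+ i.
  by rewrite coef_sum; apply: eq_bigr => i _; rewrite coefMC.
have [d0|d0] := eqVneq d 0; last first.
  apply: (acl_root d0) => [j|].
    rewrite dE; apply: acl_sum => i _; apply: aclM.
      by apply: acl_addb; case: (qP i).
    by apply/aclX/acl_mem; rewrite inE.
  apply/rootP; rewrite -[RHS]px [RHS]horner_coef /d horner_sum; apply: eq_bigr => i _.
  by rewrite hornerM hornerC; case: (qP i) => _ ->.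
(* If [d] vanishes, so do its coefficients. The one of index [j], chosen so that the leading
   coefficient of [p] has a nonzero term there, is an algebraic equation for [x] over [acl B]. *)
case: nBx; have /eqP : p`_(size p).-1 != 0 by rewrite -lead_coefE lead_coef_eq0.
set i0 := (size p).-1; have [_ ->] := qP i0 => qi0.
have [j qj] : exists j, (q i0)`_j != 0.
  apply/not_existsP => qj0; case: qi0; rewrite horner_coef big1 // => j _.
  by have /negP := qj0 j; rewrite negbK => /eqP->; rewrite mul0r.
pose r := \poly_(i < size p) (q i)`_j.
have i0s : (i0 < size p)%N by rewrite /i0 prednK // size_poly_gt0.
apply: (@acl_root _ _ r).
- by apply: contraNneq qj => r0; have := coef0 F i0; rewrite -r0 coef_poly i0s => ->.
- move=> i; rewrite coef_poly; case: ifP => _; last exact: acl0.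
  by case: (qP i).
- have rx : r.[x] = d`_j by rewrite dE horner_poly.
  by apply/rootP; rewrite rx d0 coef0.
Qed.

Fixpoint acl_indep B s : Prop :=
  if s is x :: s' then ~ acl B x /\ acl_indep (addb B [:: x]) s' else True.

Lemma acl_indep_trans B B' s : (forall x, B' x -> acl B x) -> acl_indep B s -> acl_indep B' s.
Proof.
elim: s B B' => //= x s IH B B' B'B [nBx Bs]; split.
  by move=> /(acl_trans B'B).
apply: IH Bs => y [/B'B By|ys]; first exact: acl_addb.
exact: acl_mem.
Qed.

(** Drop the first entry that becomes algebraic once [y] is adjoined: by exchange [y] is algebraic
    over that entry and the earlier ones, so the later entries stay independent. *)
Lemma acl_indep_swap B y s : acl_indep B s ->
  exists s', [/\ {subset s' <= s}, (size s <= (size s').+1)%N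
               & acl_indep (addb B [:: y]) s'].
Proof.
elim: s B => [|x s IH] B /=; first by move=> _; exists [::].
case=> nBx Bs; have [Bx|nBx'] := pselect (acl (addb B [:: y]) x).
  exists s; split=> // [z zs|]; first by rewrite inE zs orbT.
  apply: acl_indep_trans Bs => z [Bz|]; first by apply: acl_in; left.
  by rewrite inE => /eqP->; apply: acl_exchange.
have [s' [ss' szs' Bs']] := IH _ Bs.
exists (x :: s'); split=> /= [z|//|].
  by rewrite !inE => /orP[->//|/ss' ->]; rewrite orbT.
split=> //; apply: acl_indep_trans Bs' => z [[Bz|zx]|zx]; apply: acl_in.
- by left; left.
- by right.
- by left; right.
Qed.

Lemma steinitz B s t :
  acl_indep B s -> (forall x, x \in s -> acl (addb B t) x) -> (size s <= size t)%N.
Proof.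
elim: t B s => [|y t IH] B s Bs st.
  case: s Bs st => //= x s [nBx _] /(_ x (mem_head _ _)) Bx; case: nBx.
  by apply: acl_trans Bx => z [Bz|//]; apply: acl_in.
have [s' [ss' szs Bs']] := acl_indep_swap y Bs.
apply: leq_trans szs _; rewrite ltnS; apply: IH Bs' _ => x /ss' /st Bx.
apply: acl_trans Bx => z [Bz|]; first by apply/acl_in; left; left.
by rewrite inE => /orP[zy|zt]; apply: acl_in; [left; right; rewrite inE|right].
Qed.

(* [codim_ge B s k]: the transcendence degree of [s] over [B] is at most
   [size s - k]. *)
Definition codim_ge B s k : Prop :=
  exists2 t, (size t + k <= size s)%N & forall x, x \in s -> acl (addb B t) x.

Lemma codim_ge0 B s : codim_ge B s 0.
Proof. by exists s; [rewrite addn0 | move=> x; apply: acl_mem]. Qed.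

(** Transcendence degrees add in towers. The second block is measured with the first as constants,
    so conditions on some rows can be counted before those on the other coordinates. *)
Lemma codim_ge_cat B s1 s2 k1 k2 :
  codim_ge B s1 k1 -> codim_ge (addb B s1) s2 k2 -> codim_ge B (s1 ++ s2) (k1 + k2).
Proof.
move=> [t1 sz1 t1P] [t2 sz2 t2P]; exists (t1 ++ t2).
  by rewrite !size_cat addnACA leq_add.
have sub1 x : acl (addb B t1) x -> acl (addb B (t1 ++ t2)) x.
  by apply: acl_addb_sub => z zt; rewrite mem_cat zt.
move=> x; rewrite mem_cat => /orP[/t1P /sub1//|/t2P].
apply: acl_trans => y [[By|/t1P /sub1//]|yt]; first by apply: acl_addb; apply: acl_in.
by apply: acl_mem; rewrite mem_cat yt orbT.
Qed.

Lemma codim_ge_perm B s s' k : perm_eq s s' -> codim_ge B s k -> codim_ge B s' k.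
Proof.
move=> ss' [t szt tP]; exists t; first by rewrite -(perm_size ss').
by move=> x; rewrite -(perm_mem ss'); apply: tP.
Qed.

End AlgebraicClosure.

(** * Prime ideals and generic points *)

Section ClassicalFraction.
Variable R : comNzRingType.
Hypothesis integralR : GRing.integral_domain_axiom R.

(** [{fraction _}] needs a unit predicate and an inverse on the domain; classical choice supplies
    them on an arbitrary integral quotient ring. *)
Definition with_inverse : Type := R.
HB.instance Definition _ := GRing.ComNzRing.on with_inverse.

Definition cunit : {pred with_inverse} := fun x => `[< exists y, y * x = 1 >].

Definition cinv (x : with_inverse) : with_inverse :=
  if pselect (exists y, y * x = 1) is left e then projT1 (cid e) else x.

Fact cmulVx : {in cunit, left_inverse 1 cinv *%R}.
Proof.
move=> x /asboolP ux; rewrite /cinv; case: pselect => // e.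
exact: projT2 (cid e).
Qed.

Fact cunitPl (x y : with_inverse) : y * x = 1 -> cunit x.
Proof. by move=> yx; apply/asboolP; exists y. Qed.

Fact cinvr_out : {in [predC cunit], cinv =1 id}.
Proof.
by move=> x /negP ux; rewrite /cinv; case: pselect => // e; case: ux; apply/asboolP.
Qed.

HB.instance Definition _ :=
  GRing.ComNzRing_hasMulInverse.Build with_inverse cmulVx cunitPl cinvr_out.
HB.instance Definition _ :=
  GRing.ComUnitRing_isIntegral.Build with_inverse integralR.

Lemma classical_fraction :
  exists (F : fieldType) (f : {rmorphism R -> F}), injective f.
Proof.
pose f : {rmorphism with_inverse -> {fraction with_inverse}} :=
  @FracField.tofrac with_inverse.
by exists {fraction with_inverse}, f => x y /eqP; rewrite tofrac_eq => /eqP.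
Qed.

End ClassicalFraction.

Section PrimeIdeal.
Variables (R : comNzRingType) (P : R -> Prop).

Definition ideal_pred : Prop :=
  [/\ P 0, forall x y, P x -> P y -> P (x + y) & forall a x, P x -> P (a * x)].

Definition prime_pred : Prop :=
  [/\ ideal_pred, ~ P 1 & forall x y, P (x * y) -> P x \/ P y].

Hypothesis primeP : prime_pred.

Definition ideal_mem : {pred R} := fun r => `[< P r >].

Fact prime_pred_idealr : idealr_closed ideal_mem.
Proof.
have [[P0 PD PM] P1 _] := primeP; split; [exact/asboolP|exact/asboolP|].
move=> a x y /asboolP Px /asboolP Py; apply/asboolP.
by apply: PD => //; apply: PM.
Qed.

Fact prime_pred_closed : prime_idealr_closed ideal_mem.
Proof.
have [_ _ Pp] := primeP.
by move=> x y /asboolP /Pp[Px|Py]; apply/orP; [left|right]; apply/asboolP.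
Qed.

HB.instance Definition _ := isIdealr.Build R ideal_mem prime_pred_idealr.
HB.instance Definition _ := isPrimeIdealrClosed.Build R ideal_mem prime_pred_closed.

(** Passing to the fraction field of [R / P] turns a prime ideal into a point over a field: the
    images of the variables form the generic point of [P]. *)
Lemma prime_pred_field :
  exists (F : fieldType) (f : {rmorphism R -> F}), forall r, f r = 0 <-> P r.
Proof.
have [F [f f_inj]] :=
  @classical_fraction {ideal_quot ideal_mem} (@Quotient.rquot_IdomainAxiom _ _).
pose g : {rmorphism R -> {ideal_quot ideal_mem}} := \pi_{ideal_quot ideal_mem}%qT.
exists F, (f \o g) => r; rewrite -(rmorph0 f) /=.
have -> : (f (g r) = f 0) <-> (g r = 0) by split=> [/f_inj|->].
rewrite -(rmorph0 g); split => [|Pr].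
  by move/eqP; rewrite -Quotient.idealrBE subr0 => /asboolP.
by apply/eqP; rewrite -Quotient.idealrBE subr0; apply/asboolP.
Qed.

End PrimeIdeal.

Lemma prime_pred_avoiding (R : comNzRingType) (J M : R -> Prop) :
  ideal_pred J -> M 1 -> (forall x y, M x -> M y -> M (x * y)) ->
  (forall x, J x -> ~ M x) ->
  exists2 Q, prime_pred Q & (forall x, J x -> Q x) /\ (forall x, Q x -> ~ M x).
Proof.
move=> [J0 JD JM] M1 MM JnM.
(* The candidate ideal is the union of [J] and [X]; with [J] kept apart, the union of the empty
   chain is admissible too. *)
pose good (X : set R) :=
  ideal_pred (fun x => J x \/ X x) /\ forall x, X x -> ~ M x.
have [F Fgood Ftot|Q [[[Q0 QD QM] QnM] Qmax]] := @Zorn_bigcup R good.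
  split; last by move=> x [X /Fgood[_ XnM] Xx]; apply: XnM.
  split; first by left.
  - move=> x y [Jx|[X FX Xx]] [Jy|[Y FY Yy]].
    + by left; apply: JD.
    + have [[_ D _] _] := Fgood _ FY.
      by have [|] := D x y (or_introl Jx) (or_intror Yy); [left|right; exists Y].
    + have [[_ D _] _] := Fgood _ FX.
      by have [|] := D x y (or_intror Xx) (or_introl Jy); [left|right; exists X].
    + have [XY|YX] := Ftot _ _ FX FY.
        have [[_ D _] _] := Fgood _ FY.
        by have [|] := D x y (or_intror (XY _ Xx)) (or_intror Yy);
          [left|right; exists Y].
      have [[_ D _] _] := Fgood _ FX.
      by have [|] := D x y (or_intror Xx) (or_intror (YX _ Yy));
        [left|right; exists X].
  - move=> a x [Jx|[X FX Xx]]; first by left; apply: JM.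
    have [[_ _ D] _] := Fgood _ FX.
    by have [|] := D a x (or_intror Xx); [left|right; exists X].
pose I x := J x \/ Q x.
have InM x : I x -> ~ M x by case=> [/JnM|/QnM].
(* By maximality the ideal generated by [I] and [x] meets [M]. *)
have extend x : ~ I x -> exists2 a, M a & exists r, I (a - r * x).
  move=> nIx; pose X := (fun z => exists r, I (z - r * x)) : set R.
  have QX : (Q `<` X)%classic.
    split; first by move=> z Qz; exists 0; rewrite mul0r subr0; right.
    by move=> XQ; apply: nIx; right; apply: XQ; exists 1; rewrite mul1r subrr.
  have /not_andP[[]|] := Qmax X QX.
    have JX z : J z \/ X z <-> X z.
      by split=> [[Jz|//]|]; [exists 0; rewrite mul0r subr0; left|right].
    split; first by left.
      move=> y z /JX[r Ir] /JX[s Is]; apply/JX; exists (r + s).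
      by rewrite mulrDl opprD addrACA; apply: QD.
    move=> a y /JX[r Ir]; apply/JX; exists (a * r).
    by rewrite -mulrA -mulrBr; apply: QM.
  by move/existsNP => [a /not_implyP[[r Ir] /contrapT Ma]]; exists a => //; exists r.
exists I; last by split=> [x|]; [left|].
split; [split=> // | by move/InM; apply |].
move=> x y Ixy; apply: contrapT => /not_orP[/extend[a Ma [r Ir]] /extend[b Mb [s Is]]].
apply: (InM (a * b)); last exact: MM.
(* Modulo [I] the product is (r x)(s y), a multiple of x y. *)
have -> : a * b = (b - s * y) * a + ((s * y) * (a - r * x) + (s * r) * (x * y)).
  by ring.
by apply: (QD); [rewrite mulrC; apply: (QM)|apply: (QD); apply: (QM)].
Qed.

(** * Algebraic independence of the coordinates of a point *)

Section PointsOfAffineSpace.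
Variables (K : fieldType) (N : nat).
Implicit Types (U V : {set 'I_N}) (p q g : {mpoly K[N]}) (m : 'X_{1..N}).

Lemma mcoeffMXE p k m :
  (p * 'X_[k])@_m = if (k <= m)%MM then p@_(m - k)%MM else 0.
Proof.
case: ifPn => [km|nkm]; first by rewrite -{1}(submK km) addmC mcoeffMX.
apply: memN_msupp_eq0; apply: contra nkm => /msuppM_le /allpairsP[[m1 m2] /=].
by rewrite msuppX inE => -[_ /eqP-> ->]; apply: lem_addl.
Qed.

Definition supp_in U p : Prop := forall m, p@_m != 0 -> forall i, i \notin U -> m i = 0%N.

Lemma supp_inC U c : supp_in U c%:MP.
Proof.
move=> m; rewrite mcoeffC; have [->|] := eqVneq m 0%MM; first by move=> _ i _; rewrite mnm0E.
by rewrite mulr0 eqxx.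
Qed.

Lemma supp_inX U i : i \in U -> supp_in U 'X_i.
Proof.
move=> iU m; rewrite mcoeffX; have [<-|] := eqVneq U_(i)%MM m; last by rewrite eqxx.
by move=> _ j jU; rewrite mnm1E; case: eqP => // ij; rewrite -ij iU in jU.
Qed.

Lemma supp_inB U p q : supp_in U p -> supp_in U q -> supp_in U (p - q).
Proof.
move=> pU qU m; rewrite mcoeffB; have [p0|/pU//] := eqVneq p@_m 0.
by rewrite p0 sub0r oppr_eq0; apply: qU.
Qed.

Lemma supp_inD U p q : supp_in U p -> supp_in U q -> supp_in U (p + q).
Proof.
move=> pU qU m; rewrite mcoeffD; have [p0|/pU//] := eqVneq p@_m 0.
by rewrite p0 add0r; apply: qU.
Qed.

Lemma supp_inM U p q : supp_in U p -> supp_in U q -> supp_in U (p * q).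
Proof.
move=> pU qU m; rewrite -mcoeff_msupp => /msuppM_le /allpairsP[[m1 m2] /=].
rewrite !mcoeff_msupp => -[m1p m2q ->] i iU.
by rewrite mnmDE (pU _ m1p) ?(qU _ m2q).
Qed.

Lemma supp_in_sub U V p : U \subset V -> supp_in U p -> supp_in V p.
Proof.
move=> /fintype.subsetP UV pU m /pU mU i iV; apply: mU.
by apply: contra iV; apply: UV.
Qed.

Section Point.
Variables (F : fieldType) (iota : {rmorphism K -> F}) (xi : 'I_N -> F).

Definition base : F -> Prop := fun z => exists k, z = iota k.

Local Notation ev := (mmap iota xi).

Definition coords U : seq F := [seq xi i | i <- enum U].

Definition alg_indep U : Prop := forall p, supp_in U p -> ev p = 0 -> p = 0.

Lemma ev_monomial p k : ev (p * 'X_[k]) = ev p * mmap1 xi k.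
Proof. by rewrite rmorphM /= [in X in _ * X]mmapX. Qed.

Lemma acl_ev U p : supp_in U p -> acl (addb base (coords U)) (ev p).
Proof.
move=> pU; rewrite /mmap big_seq; apply: acl_sum => m; rewrite mcoeff_msupp => pm.
apply: aclM; first by apply: acl_in; left; exists p@_m.
apply: acl_prod => i _; have [iU|iU] := boolP (i \in U).
  by apply/aclX/acl_mem/map_f; rewrite mem_enum.
by rewrite (pU _ pm) // expr0; apply: acl1.
Qed.

Lemma rcl_ev U z :
  rcl (addb base (coords U)) z -> exists2 p, supp_in U p & z = ev p.
Proof.
elim=> {z}[z [[k ->]|/mapP[i]]||_ _ _ [p pU ->] _ [q qU ->]
             |_ _ _ [p pU ->] _ [q qU ->]].
- by exists k%:MP; [apply: supp_inC | rewrite mmapC].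
- rewrite mem_enum => iU ->; exists 'X_i; first exact: supp_inX.
  by rewrite mmapX mmap1U.
- by exists 1; [apply: supp_inC | rewrite rmorph1].
- by exists (p - q); [apply: supp_inB | rewrite rmorphB].
- by exists (p * q); [apply: supp_inM | rewrite rmorphM].
Qed.

Lemma alg_indep_sub U V : U \subset V -> alg_indep V -> alg_indep U.
Proof. by move=> UV Vi p /(supp_in_sub UV); apply: Vi. Qed.

Lemma alg_indep_acl V i :
  alg_indep (i |: V) -> i \notin V -> ~ acl (addb base (coords V)) (xi i).
Proof.
move=> Vi iV /acl_alg[p [p0 pV /rootP]].
have /choice[q qP] j : exists q, supp_in V q /\ p`_j = ev q.
  by have [q ? ?] := rcl_ev (pV j); exists q.
rewrite horner_coef => px.
have iVs j : supp_in (i |: V) ('X_[U_(i) *+ j] : {mpoly K[N]}).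
  move=> m; rewrite mcoeffX; have [<-|] := eqVneq (U_(i) *+ j)%MM m; last by rewrite eqxx.
  move=> _ l; rewrite !inE negb_or mulmnE mnm1E => /andP[li _].
  by rewrite eq_sym (negbTE li).
pose G := \sum_(j < size p) q j * 'X_[U_(i) *+ j].
have G0 : G = 0.
  apply: Vi.
    rewrite /G; apply: big_ind => [|x y|j _]; first exact: supp_inC.
      exact: supp_inD.
    apply: supp_inM => //; apply: (@supp_in_sub V); first exact: finset.subsetUr.
    by case: (qP j).
  rewrite /G rmorph_sum -[RHS]px; apply: eq_bigr => j _ /=.
  rewrite ev_monomial; case: (qP j) => _ ->; congr (_ * _).
  rewrite /mmap1 (bigD1 i) //= big1 => [|l li].
    by rewrite mulr1 mulmnE mnm1E eqxx mul1n.
  by rewrite mulmnE mnm1E eq_sym (negbTE li) mul0n expr0.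
set j0 := (size p).-1; have [q0V q0E] := qP j0.
have j0s : (j0 < size p)%N by rewrite /j0 prednK // size_poly_gt0.
have q0 : q j0 != 0.
  apply: contraNneq p0 => q0; rewrite -lead_coef_eq0 lead_coefE -/j0 q0E q0.
  by rewrite rmorph0.
have m0q : (q j0)@_(mlead (q j0)) != 0 by rewrite mleadc_eq0.
set m0 := mlead (q j0) in m0q.
have m0i : m0 i = 0%N by apply: q0V iV.
(* No [q j] involves the variable [i], so its exponent tells the summands apart and only [j0]
   reaches this monomial. *)
move/eqP: m0q; apply; rewrite -[RHS](mcoeff0 _ (m0 + U_(i) *+ j0)%MM) -G0 /G.
rewrite raddf_sum (bigD1 (Ordinal j0s)) //= mcoeffMXE lem_addl addmK big1.
  by rewrite addr0.
move=> j jj0; rewrite mcoeffMXE; case: ifPn => // /mnm_lepP /(_ i).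
rewrite mnmDE !mulmnE mnm1E eqxx m0i add0n !mul1n => le_jj0.
apply/eqP; apply: contraNT jj0; have [qV _] := qP j => /qV/(_ i iV).
rewrite mnmBE mnmDE !mulmnE mnm1E eqxx m0i add0n !mul1n => /eqP.
by rewrite subn_eq0 => le_j0j; rewrite -val_eqE /= eqn_leq le_jj0.
Qed.

Lemma alg_indep_acl_indep U : alg_indep U -> acl_indep base (coords U).
Proof.
rewrite /coords => Ui.
suff H s V B : uniq s -> [disjoint s & V] -> alg_indep (V :|: [set i in s]) ->
    (forall x, B x -> acl (addb base (coords V)) x) -> acl_indep B (map xi s).
  apply: (H _ finset.set0); first exact: enum_uniq.
  - by apply/pred0P => i /=; rewrite !inE andbF.
  - by apply: alg_indep_sub Ui; apply/fintype.subsetP => i; rewrite !inE mem_enum.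
  - by move=> x Bx; apply: acl_in; left.
elim: s V B => //= i s IH V B /andP[nis us].
rewrite disjoint_cons => /andP[iV sV] Vi BV; split.
  have iVi : alg_indep (i |: V).
    apply: alg_indep_sub Vi; apply/fintype.subsetP => j.
    by rewrite !inE => /orP[->|->]; rewrite ?orbT.
  by move=> /(acl_trans BV); apply: alg_indep_acl.
have xiV : acl (addb base (coords (i |: V))) (xi i).
  by apply/acl_mem/map_f; rewrite mem_enum !inE eqxx.
apply: (IH (i |: V)) => //.
- rewrite disjoint_sym; apply/pred0P => j /=; rewrite !inE.
  have [->|_] := eqVneq j i; first by rewrite (negbTE nis).
  by have /pred0P/(_ j)/= := sV; rewrite andbC.
- apply: alg_indep_sub Vi; apply/fintype.subsetP => j; rewrite !inE.
  by move=> /orP[/orP[->|->]|->]; rewrite ?orbT.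
- move=> x [/BV|]; last by rewrite inE => /eqP->.
  apply: acl_addb_sub => y /mapP[j]; rewrite mem_enum => jV ->.
  by apply: map_f; rewrite mem_enum !inE jV orbT.
Qed.

Lemma alg_indep_maximal :
  exists2 V, alg_indep V & forall i, acl (addb base (coords V)) (xi i).
Proof.
have alg_indep0 : `[< alg_indep finset.set0 >].
  apply/asboolP => p p0 pz; suff pE : p = (p@_0%MM)%:MP.
    by move: pz; rewrite pE mmapC => /eqP; rewrite fmorph_eq0 => /eqP ->; rewrite mpolyC0.
  apply/mpolyP => m; rewrite mcoeffC; have [->|m0] := eqVneq m 0%MM.
    by rewrite mulr1.
  rewrite mulr0; apply/eqP; apply: contraNT m0 => /p0 mE; apply/eqP/mnmP => i.
  by rewrite mE ?mnm0E // inE.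
have [V Vi Vmax] := @arg_maxnP _ finset.set0
  (fun V => `[< alg_indep V >]) (fun V => #|V|) alg_indep0.
move/asboolP: Vi => Vi; exists V => // i.
have [iV|iV] := boolP (i \in V); first by apply/acl_mem/map_f; rewrite mem_enum.
have : ~ alg_indep (i |: V).
  by move=> /asboolP /Vmax; rewrite cardsU1 iV add1n /= ltnn.
move/existsNP => [p /not_implyP[pV /not_implyP[pz /eqP p0]]].
set m0 := mlead p; have m0p : p@_m0 != 0 by rewrite mleadc_eq0.
pose strip (m : 'X_{1..N}) : 'X_{1..N} := [multinom (if l == i then 0%N else m l) | l < N].
have mE (m : 'X_{1..N}) : m = (strip m + U_(i) *+ m i)%MM.
  apply/mnmP => l; rewrite mnmDE mulmnE mnmE mnm1E eq_sym.
  by have [->|_] := eqVneq l i; rewrite ?mul1n ?add0n // mul0n addn0.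
(* Expansion of [p] in powers of the variable [i]: [g j] is the coefficient of the [j]-th power, and
   [g (m0 i)] is nonzero. *)
pose g j := \sum_(m <- msupp p | m i == j) p@_m *: 'X_[strip m].
have gV j : supp_in V (g j).
  rewrite /g big_seq_cond; apply: big_ind => [|x y|m /andP[mp _]].
  - exact: supp_inC.
  - exact: supp_inD.
  - rewrite -mul_mpolyC; apply: supp_inM; first exact: supp_inC.
    move=> k; rewrite mcoeffX; have [<-|] := eqVneq (strip m) k; last by rewrite eqxx.
    move=> _ l lV; rewrite mnmE; case: ifPn => // li.
    by rewrite (pV m) ?mcoeff_msupp // -?mcoeff_msupp // !inE negb_or li.
have gm0 : (g (m0 i))@_(strip m0) = p@_m0.
  rewrite /g raddf_sum big_mkcond (bigD1_seq m0) ?msupp_uniq ?mcoeff_msupp //=.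
  rewrite eqxx mcoeffZ mcoeffX eqxx mulr1 big1 ?addr0 // => m mm0.
  case: eqP => // mi; rewrite mcoeffZ mcoeffX.
  case: eqP => [sm|_]; last by rewrite mulr0.
  by move/eqP: mm0; case; rewrite (mE m) sm mi -mE.
pose P := \sum_(m <- msupp p) (ev (p@_m *: 'X_[strip m]))%:P * 'X^(m i).
have PE j : P`_j = ev (g j).
  rewrite coef_sum /g rmorph_sum big_mkcond [in RHS]big_mkcond /=.
  apply: eq_bigr => m _; rewrite coefCM coefXn eq_sym; case: eqP => _.
    by rewrite mulr1.
  by rewrite mulr0.
apply: (@acl_root _ _ P).
- apply: contraNneq m0p => P0; rewrite -gm0 (Vi (g (m0 i))) ?mcoeff0 //.
  by rewrite -PE P0 coef0.
- by move=> j; rewrite PE; apply: acl_ev.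
- apply/rootP; rewrite horner_sum -[RHS]pz [in RHS](mpolyE p) rmorph_sum.
  apply: eq_bigr => m _; rewrite hornerM hornerC hornerXn /=.
  have -> : p@_m *: 'X_[m] = p@_m *: 'X_[strip m] * 'X_[U_(i) *+ m i].
    by rewrite -scalerAl -mpolyXD -mE.
  rewrite ev_monomial; congr (_ * _).
  rewrite /mmap1 (bigD1 i) //= big1 => [|l li].
    by rewrite mulr1 mulmnE mnm1E eqxx mul1n.
  by rewrite mulmnE mnm1E eq_sym (negbTE li) mul0n expr0.
Qed.

End Point.

Lemma mmap_morph (F : fieldType) (f : {rmorphism {mpoly K[N]} -> F}) p :
  mmap (f \o @mpolyC N K) (fun i => f 'X_i) p = f p.
Proof.
rewrite [in RHS](mpolyE p) rmorph_sum; apply: eq_bigr => m _.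
rewrite -mul_mpolyC rmorphM; congr (_ * _).
by rewrite mpolyXE_id rmorph_prod; apply: eq_bigr => i _; rewrite rmorphXn.
Qed.

End PointsOfAffineSpace.

(** * Degeneration to leading forms *)

Lemma left_kernel_neq0 (K : fieldType) (a b : nat) (C : 'M[K]_(a, b)) :
  (b < a)%N -> exists2 u : 'rV[K]_a, u != 0 & u *m C = 0.
Proof.
move=> ba; have /rowV0Pn[u uC u0] : kermx C != 0.
  rewrite -mxrank_eq0 mxrank_ker -lt0n subn_gt0.
  exact: leq_ltn_trans (rank_leq_col C) ba.
by exists u => //; apply/sub_kermxP.
Qed.

Lemma seq_max (d : Order.disp_t) (T : orderType d) (s : seq T) :
  s != [::] -> exists2 x, x \in s & forall y, y \in s -> (y <= x)%O.
Proof.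
elim: s => // x s IH _; have [->|/IH[y ys ymax]] := eqVneq s [::].
  by exists x; rewrite ?mem_head // => y; rewrite inE => /eqP->.
have [xy|yx] := Order.TotalTheory.leP x y.
  exists y; first by rewrite inE ys orbT.
  by move=> z; rewrite inE => /orP[/eqP->//|/ymax].
exists x; first exact: mem_head.
move=> z; rewrite inE => /orP[/eqP->//|/ymax zy].
exact: Order.le_trans zy (Order.POrderTheory.ltW yx).
Qed.

Section Degeneration.
Variables (K : fieldType) (N : nat) (w : 'I_N -> nat).
Hypothesis w_gt0 : forall i, (0 < w i)%N.
Implicit Types (U V : {set 'I_N}) (p q g : {mpoly K[N]}) (m : 'X_{1..N}).

Definition wdeg m : nat := (\sum_i w i * m i)%N.

Lemma wdegD m1 m2 : wdeg (m1 + m2) = (wdeg m1 + wdeg m2)%N.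
Proof. by rewrite /wdeg -big_split; apply: eq_bigr => i _; rewrite mnmDE mulnDr. Qed.

Lemma wdeg_sub k m : (k <= m)%MM -> wdeg m = (wdeg (m - k) + wdeg k)%N.
Proof. by move=> km; rewrite -wdegD submK. Qed.

Lemma leq_wdeg m i : (m i <= wdeg m)%N.
Proof.
rewrite /wdeg (bigD1 i) //=; apply: leq_trans (leq_addr _ _).
by rewrite -{1}(mul1n (m i)) leq_mul.
Qed.

Section Point.
Variables (F : fieldType) (iota : {rmorphism K -> F}) (xi : 'I_N -> F).
Local Notation ev := (mmap iota xi).

(* The ideal generated by the top [w]-homogeneous forms of the polynomials
   vanishing at [xi]. *)
Definition top_ideal g : Prop := forall d, exists2 p, ev p = 0 &
  forall m, (d <= wdeg m)%N -> p@_m = if wdeg m == d then g@_m else 0.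

Lemma top_ideal_ideal : ideal_pred top_ideal.
Proof.
have J0 : top_ideal 0.
  by move=> d; exists 0; rewrite ?rmorph0 // => m _; rewrite mcoeff0 if_same.
have JD x y : top_ideal x -> top_ideal y -> top_ideal (x + y).
  move=> Jx Jy d; have [p p0 px] := Jx d; have [q q0 qy] := Jy d.
  exists (p + q); first by rewrite rmorphD /= p0 q0 addr0.
  by move=> m dm; rewrite !mcoeffD px // qy //; case: ifP; rewrite ?addr0.
(* Sums being settled, the multiplier may be a monomial up to a scalar, which shifts all weights by
   [wdeg k]. *)
split=> // a x Jx; rewrite [a]mpolyE mulr_suml; apply: big_ind => // k _.
rewrite -scalerAl [_ * x]mulrC => d; have [dk|kd] := ltnP d (wdeg k).
  exists 0; rewrite ?rmorph0 // => m _; rewrite mcoeff0 mcoeffZ mcoeffMXE.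
  case: ifP => // /eqP md; case: ifP => [/wdeg_sub|]; last by rewrite mulr0.
  by rewrite md => dE; move: dk; rewrite dE ltnNge leq_addl.
have [p p0 px] := Jx (d - wdeg k)%N; exists (a@_k *: (p * 'X_[k])).
  by rewrite -mul_mpolyC rmorphM rmorphM /= p0 mul0r mulr0.
move=> m dm; rewrite !mcoeffZ !mcoeffMXE; case: ifP => km; last first.
  by rewrite mulr0 if_same.
have mE := wdeg_sub km; rewrite px; last by rewrite leq_subLR addnC -mE.
rewrite (_ : (wdeg (m - k) == d - wdeg k)%N = (wdeg m == d)).
  by case: ifP; rewrite ?mulr0.
by rewrite mE -{2}(subnK kd) eqn_add2r.
Qed.

(* A monomial rewriting rule: at [xi], the monomial [mu] is a combination of
   smaller ones for the order comparing weights first. *)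
Definition rewrite_rule U (mu : 'X_{1..N}) p : Prop :=
  [/\ ev p = 0, p@_mu != 0, (forall i, i \notin U -> mu i = 0%N) &
      forall m, p@_m != 0 ->
        m = mu \/ (wdeg m < wdeg mu)%N \/ wdeg m = wdeg mu /\ (m < mu)%O].

(** One weight component of [g] suffices, that of its leading monomial: it is nonzero, and its
    largest monomial becomes [mu]. *)
Lemma top_ideal_rule U g : top_ideal g -> supp_in U g -> g != 0 ->
  exists mu p, rewrite_rule U mu p.
Proof.
move=> Jg gU g0; set d := wdeg (mlead g).
have [|mu] := @seq_max _ _ [seq m <- msupp g | wdeg m == d].
  rewrite -has_filter; apply/hasP; exists (mlead g); first exact: mlead_supp.
  by rewrite eqxx.
rewrite mem_filter => /andP[/eqP mud]; rewrite mcoeff_msupp => gmu mumax.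
have [p p0 pg] := Jg d; exists mu, p; split=> //.
- by rewrite pg mud // eqxx.
- exact: gU gmu.
- move=> m pm; rewrite mud; have [lt_md|le_dm] := ltnP (wdeg m) d; first by right; left.
  move: pm; rewrite pg //; case: (wdeg m =P d) => [md gm|_]; last by rewrite eqxx.
  have := mumax m; rewrite mem_filter md eqxx mcoeff_msupp gm => /(_ isT).
  by rewrite Order.POrderTheory.le_eqVlt => /orP[/eqP->|]; [left|right; right].
Qed.

(** Reduction to normal form as with a Groebner basis. A rule never raises the weight, so the bound
    [W] persists; termination is by induction on the weight, then on the monomial order. *)
Lemma monomial_span (I : finType) (mu : I -> 'X_{1..N})
    (Us : I -> {set 'I_N}) (pr : I -> {mpoly K[N]}) (J : finType)
    (st : J -> 'X_{1..N}) (W : nat) :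
  (forall i, rewrite_rule (Us i) (mu i) (pr i)) ->
  (forall m, (wdeg m <= W)%N -> (exists i, (mu i <= m)%MM) \/ exists j, st j = m) ->
  forall m, (wdeg m <= W)%N ->
  exists c : J -> K, mmap1 xi m = \sum_j iota (c j) * mmap1 xi (st j).
Proof.
move=> prP stP.
pose spanned x := exists c : J -> K, x = \sum_j iota (c j) * mmap1 xi (st j).
have spZ a x : spanned x -> spanned (iota a * x).
  move=> [c ->]; exists (fun j => a * c j); rewrite mulr_sumr.
  by apply: eq_bigr => j _; rewrite rmorphM mulrA.
have spD x y : spanned x -> spanned y -> spanned (x + y).
  move=> [c ->] [c' ->]; exists (fun j => c j + c' j); rewrite -big_split.
  by apply: eq_bigr => j _; rewrite rmorphD mulrDl.
have sp0 : spanned 0.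
  by exists (fun=> 0); rewrite big1 // => j _; rewrite rmorph0 mul0r.
move=> m; have [d md] := ubnP (wdeg m); elim: d m md => // d IHd m.
move: m; apply: ltmwf => m IHm mdd mW.
have [[i le_mu_m]|[j stj]] := stP m mW; last first.
  exists (fun j' => (j' == j)%:R); rewrite (bigD1 j) //= eqxx rmorph1 mul1r stj.
  by rewrite big1 ?addr0 // => j' /negbTE->; rewrite rmorph0 mul0r.
have [p0 pmu _ plt] := prP i.
have : ev (pr i * 'X_[m - mu i]) = 0 by rewrite rmorphM /= p0 mul0r.
rewrite [pr i]mpolyE mulr_suml rmorph_sum /= (bigD1_seq (mu i)) ?msupp_uniq //=;
  last by rewrite mcoeff_msupp.
rewrite -scalerAl -mpolyXD addmC submK // mmapZ mmapX => /eqP.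
rewrite addr_eq0 => /eqP mE.
have -> : mmap1 xi m = iota (- ((pr i)@_(mu i))^-1) *
    \sum_(m' <- msupp (pr i) | m' != mu i)
      mmap iota xi ((pr i)@_m' *: 'X_[m'] * 'X_[m - mu i]).
  apply: (mulfI (x := iota (pr i)@_(mu i))); first by rewrite fmorph_eq0.
  by rewrite mE mulrA -rmorphM mulrN mulfV // rmorphN rmorph1 mulN1r.
apply: (spZ); rewrite big_seq_cond; apply: big_ind => // m' /andP[].
rewrite mcoeff_msupp => /plt m'lt m'mu.
rewrite -scalerAl -mpolyXD mmapZ mmapX; apply: (spZ).
have mE' := wdeg_sub le_mu_m; case: m'lt => [m'E|[lt|[eqd lt]]].
- by rewrite m'E eqxx in m'mu.
- have lt' : (wdeg (m' + (m - mu i)) < wdeg m)%N.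
    by rewrite wdegD mE' addnC ltn_add2l.
  apply: IHd; first exact: leq_trans lt' _.
  exact: leq_trans (ltnW lt') mW.
- have E : wdeg (m' + (m - mu i)) = wdeg m by rewrite wdegD mE' addnC eqd.
  apply: IHm; rewrite ?E //.
  by rewrite -[X in (_ < X)%O](submK le_mu_m) [in X in (_ < X)%O]addmC ltmc_add2l.
Qed.

End Point.

End Degeneration.

(** * Counting standard monomials *)

Lemma card_ord_ltn (D e : nat) : (#|[pred x : 'I_D | (x < e)%N]| <= e)%N.
Proof.
rewrite cardE -(size_map val) -[leqRHS](size_iota 0); apply: uniq_leq_size.
  by rewrite map_inj_uniq ?enum_uniq //; apply: val_inj.
by move=> x /mapP[y]; rewrite mem_enum inE => ye ->; rewrite mem_iota.
Qed.

Lemma subset_of_card (T : finType) (B : {set T}) (v : nat) :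
  (v <= #|B|)%N -> exists2 U : {set T}, U \subset B & #|U| = v.
Proof.
move=> vB; exists [set x in take v (enum B)].
  by apply/fintype.subsetP => x; rewrite inE => /mem_take; rewrite mem_enum.
have -> : #|[set x in take v (enum B)]| = #|take v (enum B)|.
  by apply: eq_card => x; rewrite inE.
by rewrite (card_uniqP _) ?take_uniq ?enum_uniq // size_takel // -cardE.
Qed.

(** For [f] in [S] fewer than [v] coordinates are at least [e], since [v] of them would form a set
    [U] with [mu U <= f]. The other coordinates take at most [e] values, so [S] grows like the power
    [v - 1] of [D.+1]; the factor [D.+1] on the left avoids the subtraction. *)
Lemma standard_count (I : finType) (D v e : nat) (mu : {set I} -> I -> nat)
    (S : {set {ffun I -> 'I_D.+1}}) :
  (0 < e)%N ->
  (forall U : {set I}, #|U| = v -> forall i, i \notin U -> mu U i = 0%N) ->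
  (forall U i, (mu U i <= e)%N) ->
  (forall f : {ffun I -> 'I_D.+1}, f \in S ->
     forall U : {set I}, #|U| = v -> ~ (forall i, (mu U i <= f i)%N)) ->
  (#|S| * D.+1 <= #|{set I}| * (e ^ #|I| * D.+1 ^ v))%N.
Proof.
move=> e0 muU mue Sstd.
pose G (B : {set I}) i : {pred 'I_D.+1} :=
  if i \in B then predT else [pred x : 'I_D.+1 | (x < e)%N].
have cardG (B : {set I}) : (#|B| < v)%N -> (#|family (G B)| * D.+1 <= e ^ #|I| * D.+1 ^ v)%N.
  move=> Bv; rewrite card_family foldrE big_map big_enum /=.
  apply: leq_trans (_ : (e ^ #|I| * D.+1 ^ #|B|) * D.+1 <= _)%N; last first.
    by rewrite -mulnA -expnSr leq_mul2l leq_pexp2l // orbT.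
  rewrite leq_mul2r orFb (bigID (mem B)) /= mulnC leq_mul //.
    apply: leq_trans (_ : \prod_(i | i \notin B) e <= _)%N.
      by apply: leq_prod => i /negbTE iB; rewrite /G iB; apply: card_ord_ltn.
    by rewrite prod_nat_const leq_pexp2l // max_card.
  rewrite -prod_nat_const; apply: leq_prod => i iB.
  by rewrite /G iB -[leqRHS]card_ord max_card.
have SG : S \subset \bigcup_(B : {set I} | (#|B| < v)%N) [set f in family (G B)].
  apply/fintype.subsetP => f fS; apply/bigcupP.
  exists [set i | (e <= f i)%N]; last first.
    rewrite inE; apply/familyP => i; rewrite /G inE; by case: leqP.
  rewrite ltnNge; apply/negP => /subset_of_card[U /fintype.subsetP UB Uv].
  apply: (Sstd f fS U Uv) => i; have [iU|/muU->//] := boolP (i \in U).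
  by have := UB i iU; rewrite inE; exact: (leq_trans (mue U i)).
apply: leq_trans (leq_mul (subset_leq_card SG) (leqnn _)) _.
apply: (@leq_trans ((\sum_(B : {set I} | (#|B| < v)%N) #|family (G B)|) * D.+1)%N).
  rewrite leq_mul2r orFb; elim/big_rec2: _ => [|B a A _ Aa]; first by rewrite cards0.
  apply: leq_trans (leq_card_setU _ _) _; apply: leq_add => //.
  by apply: subset_leq_card; apply/fintype.subsetP => f; rewrite inE.
rewrite big_distrl /=.
apply: (@leq_trans (\sum_(B : {set I} | (#|B| < v)%N) e ^ #|I| * D.+1 ^ v)%N).
  by apply: leq_sum => B; apply: cardG.
rewrite sum_nat_const leq_mul2r; apply/orP; right.
exact: max_card.
Qed.

Section Degeneration.
Variables (K : fieldType) (N : nat) (w : 'I_N -> nat).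
Hypothesis w_gt0 : forall i, (0 < w i)%N.
Implicit Types (U V : {set 'I_N}) (p q g : {mpoly K[N]}) (m : 'X_{1..N}).
Variables (F : fieldType) (iota : {rmorphism K -> F}) (xi : 'I_N -> F).

(** A comparison of Hilbert functions: the number of monomials in [V] grows like the power [v] of
    the degree, that of standard monomials only like the power [v - 1], so in large degree a
    combination of the former vanishes at [xi]. *)
Lemma alg_indep_rules_bound V (mu : {set 'I_N} -> 'X_{1..N})
    (pr : {set 'I_N} -> {mpoly K[N]}) :
  alg_indep iota xi V ->
  (forall U, #|U| = #|V| -> rewrite_rule w iota xi U (mu U) (pr U)) -> False.
Proof.
move=> Vi prP; set v := #|V|.
pose e := (\max_(U : {set 'I_N}) mdeg (mu U)).+1.
pose A := (#|{set 'I_N}| * e ^ N)%N.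
pose O := (\sum_i w i).+1.
(* If [S] were at least as large as [X] below, the count would give [W + 1 <= A * O ^ v]; with this
   [D] the right side is at most [W]. The factor [O] in [W] bounds the weights of monomials with
   exponents at most [D]. *)
pose D := (A * O ^ v)%N.
pose W := (O * D)%N.
pose S := [set f : {ffun 'I_N -> 'I_W.+1} |
  [forall U : {set 'I_N}, (#|U| == v) ==> ~~ [forall i, mu U i <= f i]%N]].
have cardS : (#|S| * W.+1 <= #|{set 'I_N}| * (e ^ N * W.+1 ^ v))%N.
  have -> : (e ^ N = e ^ #|'I_N|)%N by rewrite card_ord.
  apply: (@standard_count _ W v e (fun U i => if #|U| == v then mu U i else 0%N)) => //.
  - move=> U Uv i iU; rewrite Uv eqxx.
    by have [_ _ mU _] := prP U Uv; apply: mU.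
  - move=> U i; case: ifP => // _.
    have mui : (mu U i <= mdeg (mu U))%N by rewrite mdegE (bigD1 i) //= leq_addr.
    apply: leq_trans mui _; apply: leqW.
    exact: (leq_bigmax (F := fun U => mdeg (mu U))).
  - move=> f; rewrite inE => /forallP fS U Uv Uf; have := fS U.
    rewrite Uv eqxx /= => /negP; apply; apply/forallP => i.
    by have := Uf i; rewrite Uv eqxx.
pose IV := {i : 'I_N | i \in V}.
pose X := {ffun IV -> 'I_D.+1}.
have cardX : #|{: X}| = (D.+1 ^ v)%N.
  by rewrite card_ffun card_ord card_sig.
have lt_SX : (#|S| < #|{: X}|)%N.
  rewrite cardX ltnNge; apply/negP => le_XS.
  have WD : (W.+1 <= O * D.+1)%N by rewrite /W mulnS -addn1 addnC leq_add2r.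
  have : (D.+1 ^ v * W.+1 <= D.+1 ^ v * (A * O ^ v))%N.
    apply: leq_trans (leq_mul le_XS (leqnn _)) _; apply: leq_trans cardS _.
    rewrite mulnA -/A [leqRHS]mulnCA -expnMn leq_mul2l mulnC; apply/orP; right.
    by elim: (v) => // i IHi; rewrite !expnS leq_mul // mulnC.
  rewrite leq_mul2l expn_eq0 /= leqNgt => /negP; apply.
  by rewrite ltnS -/D /W leq_pmull.
pose monX (f : X) : 'X_{1..N} :=
  [multinom (if insub i is Some j then f j : nat else 0%N) | i < N].
have monX_inj : injective monX.
  move=> f g /mnmP fg; apply/ffunP => j; apply: val_inj.
  by have := fg (val j); rewrite !mnmE valK.
have wX f : (wdeg w (monX f) <= W)%N.
  rewrite /W /O mulSn; apply: leq_trans (leq_addl _ _).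
  rewrite /wdeg big_distrl /=; apply: leq_sum => i _; rewrite leq_mul2l mnmE.
  by case: insubP => [j _ _|_]; rewrite ?orbT // -ltnS ltn_ord orbT.
pose J := {f : {ffun 'I_N -> 'I_W.+1} | f \in S}.
have cardJ : #|{: J}| = #|S| by rewrite card_sig.
pose st (j : J) : 'X_{1..N} := [multinom (val j i : nat) | i < N].
pose I := {U : {set 'I_N} | #|U| == v}.
have spanX (f : X) : exists c : J -> K,
    mmap1 xi (monX f) = \sum_j iota (c j) * mmap1 xi (st j).
  apply: (@monomial_span _ _ w _ iota xi I (fun U : I => mu (val U))
            (fun U : I => val U) (fun U : I => pr (val U)) J st W) => //.
    by move=> [U UV]; apply: prP; apply/eqP.
  move=> m mW; have mi i : (m i < W.+1)%N.
    by rewrite ltnS; apply: leq_trans mW; apply: leq_wdeg.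
  pose g : {ffun 'I_N -> 'I_W.+1} := [ffun i => Ordinal (mi i)].
  have [fS|] := boolP (g \in S).
    right; exists (Sub g fS); apply/mnmP => i.
    by rewrite mnmE /= ffunE.
  rewrite inE negb_forall => /existsP[U]; rewrite negb_imply negbK.
  move=> /andP[Uv /forallP Uf]; left; exists (Sub U Uv); apply/mnm_lepP => i /=.
  by have := Uf i; rewrite ffunE.
have /choice[c cP] := spanX.
(* [C] has more rows than columns; a dependency of its rows is a nonzero polynomial in the variables
   of [V] that vanishes at [xi]. *)
pose C := \matrix_(a < #|{: X}|, b < #|{: J}|) c (enum_val a) (enum_val b).
have [|u u0 uC] := @left_kernel_neq0 _ _ _ C; first by rewrite cardJ.
pose G := \sum_f u 0 (enum_rank f) *: 'X_[monX f] : {mpoly K[N]}.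
have coefG f : G@_(monX f) = u 0 (enum_rank f).
  rewrite raddf_sum (bigD1 f) //= mcoeffZ mcoeffX eqxx mulr1 big1 ?addr0 //.
  move=> g gf; rewrite mcoeffZ mcoeffX; case: eqP => [/monX_inj gE|_].
    by rewrite gE eqxx in gf.
  by rewrite mulr0.
suff G0 : G = 0.
  case/eqP: u0; apply/rowP => a; rewrite mxE -(enum_valK a) -coefG.
  by rewrite G0 mcoeff0.
apply: Vi.
  rewrite /G; apply: big_ind => [|x y|f _].
  - exact: supp_inC.
  - exact: supp_inD.
  - move=> m; rewrite mcoeffZ mcoeffX; have [<-|_] := eqVneq (monX f) m.
      by move=> _ i iV; rewrite mnmE insubF //; apply/negbTE.
    by rewrite mulr0 eqxx.
rewrite rmorph_sum /=.
transitivity (\sum_f \sum_j iota (u 0 (enum_rank f) * c f j) * mmap1 xi (st j)).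
  apply: eq_bigr => f _; rewrite mmapZ mmapX cP mulr_sumr.
  by apply: eq_bigr => j _; rewrite rmorphM mulrA.
rewrite exchange_big big1 // => j _; rewrite -mulr_suml -rmorph_sum /=.
have := congr1 (fun M : 'rV_ _ => M 0 (enum_rank j)) uC; rewrite !mxE => uCj.
rewrite (_ : \sum_(i : X) _ = 0) ?rmorph0 ?mul0r // -[RHS]uCj.
rewrite (reindex (@enum_val X {: X})) /=; last exact/onW_bij/enum_val_bij.
by apply: eq_bigr => a _; rewrite mxE enum_valK enum_rankK.
Qed.

(** Suppose [V] is a transcendence basis with more than [N - k] elements. Every [U] of the same size
    then carries a nonzero polynomial of the top ideal: otherwise some prime above that ideal avoids
    the nonzero polynomials in [U], and its generic point has [U] independent, against the bound at
    limit points. These polynomials give rewriting rules that contradict the independence of [V]. *)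
Lemma degeneration k :
  (forall (F' : fieldType) (iota' : {rmorphism K -> F'}) (eta : 'I_N -> F'),
     (forall p q d, (forall m, p@_m != 0 -> wdeg w m = d) ->
        (forall m, q@_m != 0 -> (wdeg w m < d)%N) ->
        mmap iota xi (p + q) = 0 -> mmap iota' eta p = 0) ->
     codim_ge (base iota') [seq eta i | i <- enum 'I_N] k) ->
  codim_ge (base iota) [seq xi i | i <- enum 'I_N] k.
Proof.
move=> limP; have [V Vi Vgen] := alg_indep_maximal iota xi.
have [Vk|Vk] := leqP (#|V| + k) N.
  exists (coords xi V); first by rewrite [in leqRHS]size_map size_enum_ord size_map -cardE.
  by move=> _ /mapP[i _ ->]; apply: Vgen.
have rule U : exists mup : 'X_{1..N} * {mpoly K[N]}, #|U| = #|V| ->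
    rewrite_rule w iota xi U mup.1 mup.2.
  have [UV|/eqP UV] := eqVneq #|U| #|V|; last by exists (0%MM, 0).
  suff [g [gU g0 Jg]] : exists g,
      [/\ supp_in U g, g != 0 & top_ideal w iota xi g].
    by have [mu [p pP]] := top_ideal_rule Jg gU g0; exists (mu, p).
  apply: contrapT => nog.
  pose M g := supp_in U g /\ g != 0.
  have [| |g|Q Qprime [JQ QM]] := prime_pred_avoiding (M := M)
      (top_ideal_ideal w iota xi).
  - by split; [apply: supp_inC | apply: oner_neq0].
  - move=> x y [xU x0] [yU y0]; split; first exact: supp_inM.
    exact: mulf_neq0.
  - by move=> Jg [gU g0]; apply: nog; exists g.
  have [F' [f fQ]] := prime_pred_field Qprime.
  pose iota' : {rmorphism K -> F'} := f \o @mpolyC N K.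
  pose eta i := f 'X_i.
  have evE p : mmap iota' eta p = f p by exact: mmap_morph.
  have [|t szt tP] := limP F' iota' eta.
    move=> p q d pd qd pq0; rewrite evE; apply/fQ/JQ => d'.
    have [->|d'd] := eqVneq d' d; last first.
      exists 0; first by rewrite rmorph0.
      move=> m _; rewrite mcoeff0; case: eqP => // md'; apply/esym/eqP.
      by apply: contraNT d'd => /pd <-; rewrite md'.
    exists (p + q) => // m dm; rewrite mcoeffD.
    have -> : q@_m = 0.
      by apply/eqP; apply: contraTT dm => /qd; rewrite -ltnNge.
    rewrite addr0; case: eqP => // /eqP md; apply/eqP.
    by apply: contraNT md => /pd->.
  have Ui : alg_indep iota' eta U.
    move=> p pU /eqP; rewrite evE => /eqP /fQ Qp; apply/eqP.
    by apply: contra_notT (QM p Qp).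
  move: szt Vk; rewrite size_map size_enum_ord ltnNge => szt /negP; apply.
  apply: leq_trans szt; rewrite leq_add2r -UV cardE -(size_map eta).
  apply: (steinitz (alg_indep_acl_indep Ui)) => x /mapP[i _ ->].
  by apply: tP; apply: map_f; rewrite mem_enum.
have /choice[mup mupP] := rule.
by case: (@alg_indep_rules_bound V (fun U => (mup U).1) (fun U => (mup U).2)).
Qed.

End Degeneration.

(** * Products of linear forms modulo squares *)

Definition dual (R : comNzRingType) : Type := (R * R)%type.

Section Dual.
Variable R : comNzRingType.
HB.instance Definition _ := GRing.Zmodule.on (dual R).

Definition dual_mul (u v : dual R) : dual R := (u.1 * v.1, u.1 * v.2 + u.2 * v.1).

Fact dual_mulA : associative dual_mul.
Proof. by move=> u v t; congr pair; rewrite /=; ring. Qed.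
Fact dual_mulC : commutative dual_mul.
Proof. by move=> u v; congr pair; rewrite /=; ring. Qed.
Fact dual_mul1 : left_id ((1, 0) : dual R) dual_mul.
Proof. by case=> a b; congr pair; rewrite /=; ring. Qed.
Fact dual_mulD : left_distributive dual_mul +%R.
Proof. by move=> u v t; congr pair; rewrite /=; ring. Qed.
Fact dual_1_neq0 : ((1, 0) : dual R) != 0.
Proof. by apply/eqP => -[/eqP]; rewrite oner_eq0. Qed.

HB.instance Definition _ := GRing.Zmodule_isComNzRing.Build (dual R)
  dual_mulA dual_mulC dual_mul1 dual_mulD dual_1_neq0.
End Dual.

(* [E R n] is R[e_0, ..., e_(n-1)] / (e_j ^ 2), the first generator being the
   outermost one; [lin x] is the linear form with coefficients [x]. The product
   of [k] linear forms collects the [k]-subpermanents of their coefficients. *)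
Fixpoint E (R : comNzRingType) (n : nat) : comNzRingType :=
  if n is n'.+1 then dual (E R n') else R.

Section SquareZero.
Variable R : comNzRingType.
Implicit Types (n : nat) (x : seq R).

Definition E0 n (u : E R n.+1) : E R n := (u : dual (E R n)).1.
Definition E1 n (u : E R n.+1) : E R n := (u : dual (E R n)).2.
Definition mkE n (a b : E R n) : E R n.+1 := (a, b) : dual (E R n).

Arguments E0 : simpl never.
Arguments E1 : simpl never.
Arguments mkE : simpl never.

Lemma mkE0 n (a b : E R n) : E0 (mkE a b) = a. Proof. by []. Qed.
Lemma mkE1 n (a b : E R n) : E1 (mkE a b) = b. Proof. by []. Qed.

Lemma E_eq n (u v : E R n.+1) : E0 u = E0 v -> E1 u = E1 v -> u = v.
Proof. by case: u v => [a b] [c d]; rewrite /E0 /E1 /= => -> ->. Qed.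

Lemma E0_zmod n : zmod_morphism (@E0 n). Proof. by []. Qed.
Lemma E0_monoid n : monoid_morphism (@E0 n). Proof. by []. Qed.
Lemma E1_zmod n : zmod_morphism (@E1 n). Proof. by []. Qed.
HB.instance Definition _ n := GRing.isZmodMorphism.Build _ _ (@E0 n) (@E0_zmod n).
HB.instance Definition _ n := GRing.isMonoidMorphism.Build _ _ (@E0 n) (@E0_monoid n).
HB.instance Definition _ n := GRing.isZmodMorphism.Build _ _ (@E1 n) (@E1_zmod n).

Lemma E0D n (u v : E R n.+1) : E0 (u + v) = E0 u + E0 v. Proof. by []. Qed.
Lemma E1D n (u v : E R n.+1) : E1 (u + v) = E1 u + E1 v. Proof. by []. Qed.
Lemma E0B n (u v : E R n.+1) : E0 (u - v) = E0 u - E0 v. Proof. by []. Qed.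
Lemma E1B n (u v : E R n.+1) : E1 (u - v) = E1 u - E1 v. Proof. by []. Qed.
Lemma E0M n (u v : E R n.+1) : E0 (u * v) = E0 u * E0 v. Proof. by []. Qed.
Lemma E00 n : E0 (0 : E R n.+1) = 0. Proof. by []. Qed.
Lemma E10 n : E1 (0 : E R n.+1) = 0. Proof. by []. Qed.
Lemma E1M n (u v : E R n.+1) : E1 (u * v) = E0 u * E1 v + E1 u * E0 v.
Proof. by []. Qed.

Lemma E01 n : E0 (1 : E R n.+1) = 1. Proof. by []. Qed.
Lemma E11 n : E1 (1 : E R n.+1) = 0. Proof. by []. Qed.

(** [E1] is the derivative along the outermost generator, so this is the product rule. *)
Lemma E1_prod n (I : finType) (P : pred I) (u : I -> E R n.+1) :
  E1 (\prod_(i | P i) u i) =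
  \sum_(i | P i) E1 (u i) * \prod_(l | P l && (l != i)) E0 (u l).
Proof.
have [k Pk] := ubnP #|P|; elim: k P Pk => // k IH P Pk.
have [i Pi|P0] := pickP P; last by rewrite !big_pred0 // E11.
rewrite [in LHS](bigD1 i) //= E1M IH; last first.
  by move: Pk; rewrite (cardD1 i) unfold_in Pi ltnS; apply: leq_ltn_trans;
     apply: subset_leq_card; apply/fintype.subsetP => j; rewrite !inE unfold_in andbC.
rewrite [in RHS](bigD1 i) //= addrC rmorph_prod; congr (_ + _).
rewrite mulr_sumr; apply: eq_bigr => j /andP[Pj ji].
rewrite mulrCA; congr (_ * _); rewrite [in RHS](bigD1 i) //=; last first.
  by rewrite Pi eq_sym.
by congr (_ * _); apply: eq_bigl => l; rewrite -!andbA [(l != i) && _]andbC.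
Qed.

Fixpoint cE n : R -> E R n :=
  if n is n'.+1 then fun c => mkE (cE n' c) 0 else id.

Fixpoint lin n x : E R n :=
  if n is n'.+1 then mkE (lin n' (behead x)) (cE n' (head 0 x)) else 0.

Lemma cE_zmod n : zmod_morphism (cE n).
Proof. by elim: n => // n IH a b; apply: E_eq; rewrite raddfB ?mkE0 ?mkE1 ?IH ?subrr. Qed.
HB.instance Definition _ n := GRing.isZmodMorphism.Build R (E R n) (cE n) (@cE_zmod n).

Lemma cES n c : cE n.+1 c = mkE (cE n c) 0. Proof. by []. Qed.
Lemma linS n x : lin n.+1 x = mkE (lin n (behead x)) (cE n (head 0 x)).
Proof. by []. Qed.

Lemma cE_monoid n : monoid_morphism (cE n).
Proof.
elim: n => // n [IH1 IHM]; split=> [|a b]; first by apply: E_eq; rewrite cES ?mkE0 ?IH1.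
rewrite !cES; apply: E_eq; first by rewrite E0M !mkE0 IHM.
by rewrite E1M !mkE1 mulr0 mul0r addr0.
Qed.
HB.instance Definition _ n := GRing.isMonoidMorphism.Build R (E R n) (cE n) (@cE_monoid n).

Lemma lin_scale n c x : lin n [seq c * a | a <- x] = cE n c * lin n x.
Proof.
elim: n x => [|n IH] x /=; first by rewrite mulr0.
have -> : behead [seq c * a | a <- x] = [seq c * a | a <- behead x] by case: x.
have -> : head 0 [seq c * a | a <- x] = c * head 0 x by case: x => /=; rewrite ?mulr0.
apply: E_eq; first by rewrite E0M !mkE0 IH.
by rewrite E1M !mkE0 !mkE1 mul0r addr0 rmorphM.
Qed.

Fixpoint coefall (Q : R -> Prop) n : E R n -> Prop :=
  if n is n'.+1 then fun u => coefall Q (E0 u) /\ coefall Q (E1 u) else Q.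

Lemma coefall0 Q n : Q 0 -> coefall Q (0 : E R n).
Proof. by move=> Q0; elim: n => //= n IH; rewrite E00 E10. Qed.

Lemma coefall_cE Q n c : Q 0 -> Q c -> coefall Q (cE n c).
Proof. by move=> Q0 Qc; elim: n => //= n IH; split=> //; apply: coefall0. Qed.

Lemma coefallD Q n (u v : E R n) : (forall a b, Q a -> Q b -> Q (a + b)) ->
  coefall Q u -> coefall Q v -> coefall Q (u + v).
Proof.
move=> QD; elim: n u v => [|n IH] u v /=; first exact: QD.
by move=> [u0 u1] [v0 v1]; rewrite E0D E1D; split; apply: IH.
Qed.

(** Three predicates allow both uses: closure of a subfield and addition of weights. *)
Lemma coefallM Q1 Q2 Q n (u v : E R n) :
  (forall a b, Q a -> Q b -> Q (a + b)) ->
  (forall a b, Q1 a -> Q2 b -> Q (a * b)) ->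
  coefall Q1 u -> coefall Q2 v -> coefall Q (u * v).
Proof.
move=> QD QM; elim: n u v => [|n IH] u v /=; first exact: QM.
move=> [u0 u1] [v0 v1]; rewrite E0M E1M; split; first exact: IH.
by apply: coefallD => //; apply: IH.
Qed.

Lemma coefall_lin Q n x : Q 0 -> (forall a, a \in x -> Q a) -> coefall Q (lin n x).
Proof.
move=> Q0; elim: n x => //= n IH x Qx; split.
  by apply: IH => a /mem_behead; apply: Qx.
by apply: coefall_cE => //; case: x Qx => //= a x; apply; rewrite mem_head.
Qed.

Fixpoint deg_le d n : E R n -> Prop :=
  if n is n'.+1 then fun u =>
    deg_le d (E0 u) /\ (if d is d'.+1 then deg_le d' (E1 u) else E1 u = 0)
  else fun _ => True.

Lemma deg_le0 d n : deg_le d (0 : E R n).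
Proof. by elim: n d => //= n IH d; rewrite E00 E10; split=> //; case: d. Qed.

Lemma deg_le_cE d n c : deg_le d (cE n c).
Proof. by elim: n d => //= n IH d; split=> //; case: d => // d; apply: deg_le0. Qed.

Lemma deg_le_lin n x : deg_le 1 (lin n x).
Proof. by elim: n x => //= n IH x; split; [apply: IH | apply: deg_le_cE]. Qed.

Lemma deg_leD d n (u v : E R n) : deg_le d u -> deg_le d v -> deg_le d (u + v).
Proof.
elim: n d u v => //= n IH d u v [u0 u1] [v0 v1].
rewrite E0D E1D; split; first exact: IH.
by case: d u1 v1 {u0 v0} => [->->|d ? ?]; [rewrite addr0 | apply: IH].
Qed.

Lemma deg_le_leq d d' n (u : E R n) : (d <= d')%N -> deg_le d u -> deg_le d' u.
Proof.
elim: n d d' u => //= n IH d d' u dd' [u0 u1]; split; first exact: IH u0.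
case: d' d dd' u0 u1 => [|d'] [|d] // dd' _ u1; first by rewrite u1; apply: deg_le0.
exact: IH u1.
Qed.

Lemma deg_leM d d' n (u v : E R n) : deg_le d u -> deg_le d' v -> deg_le (d + d') (u * v).
Proof.
elim: n d d' u v => //= n IH d d' u v [u0 u1] [v0 v1].
rewrite E0M E1M; split; first exact: IH.
case: d d' u0 u1 v0 v1 => [|d] [|d'] u0 u1 v0 v1 //=.
- by rewrite u1 v1 mulr0 mul0r addr0.
- by rewrite u1 mul0r addr0; apply: (IH 0%N).
- by rewrite v1 mulr0 add0r; apply: IH.
- by apply: deg_leD; [rewrite addnS; apply: (IH d.+1) | apply: IH].
Qed.

Lemma deg_le_prod n (I : finType) (P : pred I) (u : I -> E R n) :
  (forall i, deg_le 1 (u i)) -> deg_le #|P| (\prod_(i | P i) u i).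
Proof.
move=> u1; rewrite -sum1_card; elim/big_rec2: _ => [|i d v _ dv].
  by rewrite -(rmorph1 (cE n)); apply: deg_le_cE.
exact: deg_leM.
Qed.

End SquareZero.

Section Functoriality.
Variables (R S : comNzRingType) (f : {rmorphism R -> S}).

Fixpoint emap n : E R n -> E S n :=
  if n is n'.+1 then fun u => mkE (emap (E0 u)) (emap (E1 u)) else f.

Lemma emapS n (u : E R n.+1) : emap u = mkE (emap (E0 u)) (emap (E1 u)).
Proof. by []. Qed.

Lemma emap_zmod n : zmod_morphism (@emap n).
Proof.
elim: n => [|n IH] /= u v; first exact: rmorphB.
by apply: E_eq; rewrite !(E0B, E1B, mkE0, mkE1) IH.
Qed.
HB.instance Definition _ n := GRing.isZmodMorphism.Build _ _ (@emap n) (@emap_zmod n).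

Lemma emap_monoid n : monoid_morphism (@emap n).
Proof.
elim: n => [|n [IH1 IHM]]; first by split; [apply: rmorph1 | apply: rmorphM].
split=> [|u v].
  by apply: E_eq; rewrite emapS !(mkE0, mkE1, E01, E11) ?IH1 ?raddf0.
by apply: E_eq; rewrite !emapS !(E0M, E1M, mkE0, mkE1) ?raddfD /= !IHM.
Qed.
HB.instance Definition _ n := GRing.isMonoidMorphism.Build _ _ (@emap n) (@emap_monoid n).

Lemma emap_cE n c : emap (cE n c) = cE n (f c).
Proof. by elim: n => // n IH; rewrite cES emapS mkE0 mkE1 IH raddf0. Qed.

Lemma emap_lin n x : emap (lin n x) = lin n [seq f a | a <- x].
Proof.
elim: n x => [|n IH] x; first exact: rmorph0.
rewrite !linS emapS mkE0 mkE1 IH emap_cE.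
by case: x => //=; rewrite rmorph0.
Qed.

End Functoriality.

(** * Codimension forced by equations in the square-zero algebra *)

Section Relations.
Variables (F : fieldType) (two_neq0 : 2%:R != 0 :> F).
Implicit Types (B : F -> Prop) (x : seq F).

Definition Eacl B n (u : E F n) := coefall (acl B) u.

Lemma EaclD B n (u v : E F n) : Eacl B u -> Eacl B v -> Eacl B (u + v).
Proof. by apply: coefallD => a b; apply: aclD. Qed.

Lemma EaclM B n (u v : E F n) : Eacl B u -> Eacl B v -> Eacl B (u * v).
Proof. by apply: coefallM => a b; [apply: aclD | apply: aclM]. Qed.

Lemma Eacl_cE B n c : acl B c -> Eacl B (cE n c).
Proof. by apply: coefall_cE; apply: acl0. Qed.

Lemma EaclN B n (u : E F n) : Eacl B u -> Eacl B (- u).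
Proof.
move=> Bu; rewrite -mulN1r; apply: EaclM => //.
by rewrite -(rmorphN1 (cE n)); apply/Eacl_cE/aclN/acl1.
Qed.

Lemma Eacl_sum B n (I : Type) (r : seq I) (P : pred I) (u : I -> E F n) :
  (forall i, P i -> Eacl B (u i)) -> Eacl B (\sum_(i <- r | P i) u i).
Proof.
move=> Bu; apply: big_ind => //; last by move=> a b; apply: EaclD.
by apply: coefall0; apply: acl0.
Qed.

Lemma Eacl_prod B n (I : Type) (r : seq I) (P : pred I) (u : I -> E F n) :
  (forall i, P i -> Eacl B (u i)) -> Eacl B (\prod_(i <- r | P i) u i).
Proof.
move=> Bu; apply: big_ind => //; last by move=> a b; apply: EaclM.
by rewrite -(rmorph1 (cE n)); apply/Eacl_cE/acl1.
Qed.

Lemma Eacl_lin B n x : (forall a, a \in x -> acl B a) -> Eacl B (lin n x).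
Proof. by apply: coefall_lin; apply: acl0. Qed.

Lemma Eacl_trans B B' n (u : E F n) :
  (forall y, B y -> acl B' y) -> Eacl B u -> Eacl B' u.
Proof.
move=> BB'; elim: n u => [|n IH] u /=; first exact: acl_trans.
by case=> u0 u1; split; apply: IH.
Qed.

Lemma Eacl_addb B s n (u : E F n) : Eacl B u -> Eacl (addb B s) u.
Proof. by apply: Eacl_trans => y By; apply: acl_in; left. Qed.

(** Some coefficient of [u] is nonzero, and there [c] is a quotient of coefficients. Each condition
    counted below comes from such a division. *)
Lemma acl_solve B n c (u v : E F n) :
  Eacl B u -> Eacl B v -> u != 0 -> cE n c * u = v -> acl B c.
Proof.
elim: n u v => [|n IH] /= u v Bu Bv u0 cuv.
  by rewrite -[c](mulfK u0) cuv; apply: aclM => //; apply: aclV.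
have [Bu0 Bu1] := Bu; have [Bv0 Bv1] := Bv.
have [u00|u00] := eqVneq (E0 u) 0; last first.
  by apply: (IH _ _ Bu0 Bv0 u00); rewrite -cuv rmorphM.
have u10 : E1 u != 0.
  by apply: contraNneq u0 => u10; apply/eqP/E_eq; rewrite ?u00 ?u10 raddf0.
apply: (IH _ _ Bu1 Bv1 u10); rewrite -cuv E1M mkE0 mkE1.
by rewrite mul0r addr0.
Qed.

Lemma codim_ge_cons B c x k : codim_ge B x k -> codim_ge B (c :: x) k.
Proof.
move=> [t szt tP]; exists (c :: t) => //= y; rewrite inE => /orP[/eqP->|/tP].
  by apply: acl_mem; apply: mem_head.
by apply: acl_addb_sub => z zt; rewrite inE zt orbT.
Qed.

Lemma codim_ge_cons_acl B c x k :
  acl (addb B x) c -> codim_ge B x k -> codim_ge B (c :: x) k.+1.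
Proof.
move=> cx [t szt tP]; exists t; first by rewrite addnS.
move=> y; rewrite inE => /orP[/eqP->|/tP//].
by apply: acl_trans cx => z [Bz|/tP//]; apply: acl_addb; apply: acl_in.
Qed.

Lemma codim_ge_mem B s s' k :
  size s' = size s -> {subset s' <= s} -> codim_ge B s k -> codim_ge B s' k.
Proof. by move=> sz ss' [t szt tP]; exists t; rewrite ?sz // => y /ss' /tP. Qed.

Lemma Eacl_lin_addb B n x : Eacl (addb B x) (lin n x).
Proof. by apply: Eacl_lin => a; apply: acl_mem. Qed.

(** Split off the outermost generator e: the product (x + c e)(v0 + v1 e) vanishes, so c v0 = - x
    v1. If v0 is nonzero this determines c; otherwise v1 has smaller degree in one generator
    fewer. *)
Lemma annihilator_codim_ge1 B n d (v : E F n) x : size x = n ->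
  (d < n)%N -> deg_le d v -> v != 0 -> Eacl B v -> lin n x * v = 0 -> codim_ge B x 1.
Proof.
elim: n d v x => // n IH d v [|c x] //= [szx] dn [v0 v1] vn0 [Bv0 Bv1] xv.
have xv0 : lin n x * E0 v = 0 by have := congr1 (@E0 _ _) xv; rewrite rmorphM.
have := congr1 (@E1 _ _) xv; rewrite E1M mkE0 mkE1 raddf0 => xv1.
have [v00|v00] := eqVneq (E0 v) 0; last first.
  apply: codim_ge_cons_acl (codim_ge0 _ _).
  apply: (@acl_solve _ n c (E0 v) (- (lin n x * E1 v))) => //.
  - exact: Eacl_addb.
  - by apply/EaclN/EaclM; [apply: Eacl_lin_addb | apply: Eacl_addb].
  - by apply/eqP; rewrite -addr_eq0 addrC xv1.
have v10 : E1 v != 0.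
  by apply: contraNneq vn0 => v10; apply/eqP/E_eq; rewrite ?v00 ?v10 raddf0.
case: d dn v0 v1 => [|d] dn v0 v1; first by rewrite v1 eqxx in v10.
apply: codim_ge_cons; apply: (IH d (E1 v)) => //.
by move: xv1; rewrite v00 mulr0 addr0.
Qed.

(** The same splitting also gives x v0 = 0. When v0 is nonzero this is a condition on x alone,
    independent of the one that determines c. *)
Lemma annihilator_codim_ge2 B n d (v : E F n) x : size x = n ->
  (d.+1 < n)%N -> deg_le d v -> v != 0 -> Eacl B v -> lin n x * v = 0 -> codim_ge B x 2.
Proof.
elim: n d v x => // n IH d v [|c x] //= [szx] dn [v0 v1] vn0 [Bv0 Bv1] xv.
have xv0 : lin n x * E0 v = 0 by have := congr1 (@E0 _ _) xv; rewrite rmorphM.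
have := congr1 (@E1 _ _) xv; rewrite E1M mkE0 mkE1 raddf0 => xv1.
have [v00|v00] := eqVneq (E0 v) 0; last first.
  apply: codim_ge_cons_acl; last exact: (@annihilator_codim_ge1 _ _ d (E0 v)).
  apply: (@acl_solve _ n c (E0 v) (- (lin n x * E1 v))) => //.
  - exact: Eacl_addb.
  - by apply/EaclN/EaclM; [apply: Eacl_lin_addb | apply: Eacl_addb].
  - by apply/eqP; rewrite -addr_eq0 addrC xv1.
have v10 : E1 v != 0.
  by apply: contraNneq vn0 => v10; apply/eqP/E_eq; rewrite ?v00 ?v10 raddf0.
case: d dn v0 v1 => [|d] dn v0 v1; first by rewrite v1 eqxx in v10.
apply: codim_ge_cons; apply: (IH d (E1 v)) => //.
by move: xv1; rewrite v00 mulr0 addr0.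
Qed.

(** The e-component of the equation is 2 c x v0 + x^2 v1 = 0. It determines c unless x v0 = 0, and
    then x itself satisfies a linear condition. *)
Lemma square_annihilator_codim_ge1 B n d (v : E F n) x : size x = n ->
  (d.+1 < n)%N -> deg_le d v -> v != 0 -> Eacl B v -> lin n x * (lin n x * v) = 0 ->
  codim_ge B x 1.
Proof.
elim: n d v x => // n IH d v [|c x] //= [szx] dn [v0 v1] vn0 [Bv0 Bv1] xxv.
have xv0 : lin n x * (lin n x * E0 v) = 0.
  by have := congr1 (@E0 _ _) xxv; rewrite !rmorphM.
have := congr1 (@E1 _ _) xxv; rewrite E1M E1M E0M !(mkE0, mkE1) => xv1.
have [v00|v00] := eqVneq (E0 v) 0; last first.
  have [xv00|xv00] := eqVneq (lin n x * E0 v) 0.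
    by apply: codim_ge_cons; apply: (@annihilator_codim_ge1 _ _ d (E0 v)).
  have two (u : E F n) : cE n 2%:R * u = u + u by rewrite rmorph_nat mulr_natl.
  apply: codim_ge_cons_acl (codim_ge0 _ _).
  apply: (@acl_solve _ n c (cE n 2%:R * (lin n x * E0 v))
                       (- (lin n x * (lin n x * E1 v)))).
  - apply: EaclM; last by apply: EaclM; [apply: Eacl_lin_addb | apply: Eacl_addb].
    by apply: Eacl_cE; apply: aclD; apply: acl1.
  - apply/EaclN/EaclM; first exact: Eacl_lin_addb.
    by apply: EaclM; [apply: Eacl_lin_addb | apply: Eacl_addb].
  - apply: contraNneq xv00 => E20.
    rewrite -[lin n x * _]mul1r -(rmorph1 (cE n)) -(mulVf two_neq0) rmorphM -mulrA.
    by rewrite E20 mulr0.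
  - apply/eqP; rewrite -addr_eq0 two -[X in _ == X]xv1; apply/eqP.
    by move: (lin n x) (cE n c) (E0 v) (E1 v) => a b e g; ring.
have v10 : E1 v != 0.
  by apply: contraNneq vn0 => v10; apply/eqP/E_eq; rewrite ?v00 ?v10 raddf0.
case: d dn v0 v1 => [|d] dn v0 v1; first by rewrite v1 eqxx in v10.
apply: codim_ge_cons; apply: (IH d (E1 v)) => //.
by move: xv1; rewrite v00 !mulr0 !addr0.
Qed.

End Relations.

Section CoordinateRelations.
Variables (F : fieldType) (I : finType) (a : I -> F).
Implicit Types (B : F -> Prop).

Lemma codim_ge1_of B i :
  acl (addb B [seq a j | j <- enum I & j != i]) (a i) ->
  codim_ge B [seq a j | j <- enum I] 1.
Proof.
move=> ai; apply: codim_ge_perm (codim_ge_cons_acl ai (codim_ge0 _ _)).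
rewrite -(map_cons a) perm_sym; apply: perm_map; rewrite -rem_filter ?enum_uniq //.
by apply: perm_to_rem; rewrite mem_enum.
Qed.

(** The equation of index [k0] does not contain [a k0] and determines [a i0]; by symmetry the one of
    index [i0] determines [a k0] without [a i0]. So the two conditions are independent. *)
Lemma linear_codim_ge2 B n (q : I -> I -> E F n) i0 k0 :
  (forall i k, Eacl B (q i k)) -> (forall i k, q i k = q k i) ->
  (forall k, \sum_(i | i != k) cE n (a i) * q i k = 0) ->
  i0 != k0 -> q i0 k0 != 0 -> codim_ge B [seq a j | j <- enum I] 2.
Proof.
move=> qB qC qa ik qik.
pose s := [seq j <- rem i0 (enum I) | j != k0].
have mem_s j : (j \in s) = (j != k0) && (j != i0).
  by rewrite mem_filter mem_rem_uniq ?enum_uniq // inE mem_enum andbT.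
have solve B' i k : (forall x, B x -> acl B' x) -> i != k -> q i k != 0 ->
    (forall j, j != i -> j != k -> acl B' (a j)) -> acl B' (a i).
  move=> BB' neq_ik qik0 aB'.
  have qB' i' k' : Eacl B' (q i' k') by apply: Eacl_trans BB' _.
  apply: (@acl_solve _ B' n (a i) (q i k)
    (- \sum_(j | (j != k) && (j != i)) cE n (a j) * q j k)) => //.
    apply/EaclN/Eacl_sum => j /andP[jk ji].
    by apply: EaclM => //; apply/Eacl_cE/aB'.
  by apply/eqP; rewrite -addr_eq0 -[X in _ == X](qa k) [in X in _ == X](bigD1 i).
have perm_s : perm_eq (i0 :: k0 :: s) (enum I).
  rewrite perm_sym; apply: perm_trans (perm_to_rem (x := i0) _) _.
    by rewrite mem_enum.
  rewrite perm_cons /s -rem_filter ?rem_uniq ?enum_uniq //; apply: perm_to_rem.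
  by rewrite mem_rem_uniq ?enum_uniq // inE mem_enum eq_sym ik.
apply: codim_ge_perm (perm_map a perm_s) _ => /=.
apply: codim_ge_cons_acl.
  apply: (solve _ i0 k0) => // [x Bx|j ji jk]; first by apply: acl_in; left.
  by apply: acl_mem; rewrite inE map_f ?orbT // mem_s jk.
apply: codim_ge_cons_acl (codim_ge0 _ _).
apply: (solve _ k0 i0) => [x Bx|||j jk ji].
- by apply: acl_in; left.
- by rewrite eq_sym.
- by rewrite qC.
- by apply/acl_mem/map_f; rewrite mem_s jk.
Qed.

(** The form has no squares, so it is linear in [a i0] with coefficient [2 L]. If [L] is nonzero
    this determines [a i0]; if not, [L = 0] determines [a k0]. *)
Lemma quadratic_codim_ge1 B n (u : I -> I -> E F n) i0 k0 : 2%:R != 0 :> F ->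
  (forall i k, Eacl B (u i k)) -> (forall i k, u i k = u k i) ->
  \sum_i cE n (a i) * (\sum_(k | k != i) cE n (a k) * u i k) = 0 ->
  i0 != k0 -> u i0 k0 != 0 -> codim_ge B [seq a j | j <- enum I] 1.
Proof.
move=> two_neq0 uB uC ua ik uik.
have uBs s i k : Eacl (addb B s) (u i k) by apply: Eacl_addb.
have mem_a i j : j != i -> acl (addb B [seq a j | j <- enum I & j != i]) (a j).
  by move=> ji; apply/acl_mem/map_f; rewrite mem_filter ji mem_enum.
set L := \sum_(k | k != i0) cE n (a k) * u i0 k.
have [L0|L0] := eqVneq L 0; last first.
  apply: (@codim_ge1_of _ i0).
  pose R := \sum_(i | i != i0) cE n (a i) *
              \sum_(k | (k != i) && (k != i0)) cE n (a k) * u i k.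
  apply: (@acl_solve _ _ n (a i0) (cE n 2%:R * L) (- R)).
  - apply: EaclM; first by apply: Eacl_cE; apply: aclD; apply: acl1.
    by apply: Eacl_sum => k ki; apply: EaclM => //; apply/Eacl_cE/mem_a.
  - apply/EaclN/Eacl_sum => i ii0; apply: EaclM; first exact/Eacl_cE/mem_a.
    by apply: Eacl_sum => k /andP[ki ki0]; apply: EaclM => //; apply/Eacl_cE/mem_a.
  - apply: contraNneq L0 => E20.
    by rewrite -[L]mul1r -(rmorph1 (cE n)) -(mulVf two_neq0) rmorphM -mulrA E20 mulr0.
  - apply/eqP; rewrite -addr_eq0 -[X in _ == X]ua [in X in _ == X](bigD1 i0) //= -/L.
    apply/eqP; rewrite rmorph_nat mulr_natl mulr2n mulrDr -addrA; congr (_ + _).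
    rewrite mulr_sumr /R -big_split; apply: eq_bigr => i ii0 /=.
    rewrite [in RHS](bigD1 i0) 1?eq_sym //= mulrDr; congr (_ + _).
    by rewrite uC mulrCA.
apply: (@codim_ge1_of _ k0).
apply: (@acl_solve _ _ n (a k0) (u i0 k0)
  (- \sum_(k | (k != i0) && (k != k0)) cE n (a k) * u i0 k)) => //.
  by apply/EaclN/Eacl_sum => k /andP[ki kk]; apply: EaclM => //; apply/Eacl_cE/mem_a.
by apply/eqP; rewrite -addr_eq0 -[X in _ == X]L0 /L [in X in _ == X](bigD1 k0) //= eq_sym.
Qed.

End CoordinateRelations.

Section OmittedProducts.
Variables (R : comNzRingType) (m n : nat).
Implicit Types (rr : 'I_m -> E R n) (aa : 'I_m -> R).

(** In the notation of the overview, [omit1], [omit2] and [lin_omit2] are z_k, w_ik and y_k. *)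
Definition omit1 rr k : E R n := \prod_(l | l != k) rr l.

Definition omit2 rr i k : E R n := \prod_(l | (l != i) && (l != k)) rr l.

Definition lin_omit2 aa rr k : E R n := \sum_(i | i != k) cE n (aa i) * omit2 rr i k.

Lemma omit1_ord1 rr k : m = 1%N -> omit1 rr k = 1.
Proof.
move=> m1; rewrite /omit1 big_pred0 // => l; apply/negbTE; rewrite negbK.
by apply/eqP/val_inj; case: l k => l lm [k km] /=; lia.
Qed.

Lemma omit2C rr i k : omit2 rr i k = omit2 rr k i.
Proof. by apply: eq_bigl => l; rewrite andbC. Qed.

End OmittedProducts.

Lemma prod_lift (R : comNzRingType) m (p : 'I_m.+1) (P : pred 'I_m.+1) (f : 'I_m.+1 -> R) :
  \prod_(l | (l != p) && P l) f l = \prod_(l | P (lift p l)) f (lift p l).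
Proof.
rewrite (reindex_omap (lift p) (unlift p)) => [|l /andP[lp _]].
  by apply: eq_bigl => l; rewrite liftK eqxx andbT eq_sym neq_lift.
by case: unliftP lp => [j ->|->]; rewrite ?eqxx.
Qed.

Lemma ord_neq_gt1 m (i k : 'I_m) : i != k -> (1 < m)%N.
Proof.
by case: m i k => [|[|m]] i k //; [case: i | rewrite (ord1 i) (ord1 k)].
Qed.

Section Bounds.
Variable K : fieldType.

Definition crit_bound m n : Prop :=
  forall (F : fieldType) (iota : {rmorphism K -> F}) (r : 'I_m -> seq F),
    (forall i, size (r i) = n) -> (forall i, omit1 (fun l => lin n (r l)) i = 0) ->
    codim_ge (base iota) (flatten [seq r i | i <- enum 'I_m]) (2 * n).

Definition crit2_bound m n : Prop :=
  forall (F : fieldType) (iota : {rmorphism K -> F}) (r : 'I_m -> seq F),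
    (forall i, size (r i) = n) ->
    (forall i k, i != k -> omit2 (fun l => lin n (r l)) i k = 0) ->
    codim_ge (base iota) (flatten [seq r i | i <- enum 'I_m]) (2 * n).+2.

Lemma flatten_enum_ordS (T : Type) m (r : 'I_m.+1 -> seq T) :
  flatten [seq r i | i <- enum 'I_m.+1] =
  r ord0 ++ flatten [seq r (lift ord0 i) | i <- enum 'I_m].
Proof. by rewrite enum_ordSl /= -map_comp. Qed.

Lemma mem_flatten_enum (T : eqType) m (r : 'I_m -> seq T) i x :
  x \in r i -> x \in flatten [seq r i | i <- enum 'I_m].
Proof.
by move=> xr; apply/flattenP; exists (r i) => //; apply/map_f; rewrite mem_enum.
Qed.

Lemma omit2_Eacl (F : fieldType) (B : F -> Prop) m n (r : 'I_m -> seq F) i k :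
  Eacl (addb B (flatten [seq r i | i <- enum 'I_m]))
       (omit2 (fun l => lin n (r l)) i k).
Proof.
apply: Eacl_prod => l _; apply: Eacl_lin => x xr.
exact/acl_mem/(mem_flatten_enum xr).
Qed.

Lemma omit2_deg_le (R : comNzRingType) m n (r : 'I_m -> seq R) i k : i != k ->
  deg_le (m - 2) (omit2 (fun l => lin n (r l)) i k).
Proof.
move=> ik; apply: deg_le_leq (deg_le_prod _ (fun l => deg_le_lin n (r l))).
have := cardC [set i; k]; rewrite cards2 ik card_ord => mE.
have -> : (m - 2 = #|[predC [set i; k]]|)%N by rewrite -[X in (X - _)%N]mE addnC addnK.
apply: subset_leq_card.
by apply/fintype.subsetP => l; rewrite !inE negb_or.
Qed.

(** Induction on the number of rows. Without the first row, the others satisfy the hypothesis of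
    [crit_bound]. If some product omitting two of them is nonzero, the first row annihilates it,
    which costs two conditions; otherwise the claim for one row fewer applies. *)
Lemma crit2_bound_of n :
  (forall m, (0 < m <= n)%N -> crit_bound m n) ->
  forall m, (1 < m <= n)%N -> crit2_bound m n.
Proof.
move=> critP; elim=> // m IH mn F iota r sz w0.
pose r' i := r (lift ord0 i).
have w0' i k : i != k -> lin n (r ord0) * omit2 (fun l => lin n (r' l)) i k = 0.
  move=> ik; rewrite -(w0 (lift ord0 i) (lift ord0 k)); last first.
    by rewrite (inj_eq lift_inj).
  rewrite /omit2 [in RHS](bigD1 ord0); last by rewrite !neq_lift.
  congr (_ * _); rewrite [RHS]big_andbC prod_lift.
  by apply: eq_bigl => l; rewrite !(inj_eq lift_inj).
have z0' i : omit1 (fun l => lin n (r' l)) i = 0.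
  rewrite -(w0 ord0 (lift ord0 i)) ?neq_lift // /omit2 prod_lift.
  by apply: eq_bigl => l; rewrite (inj_eq lift_inj).
have codim_ge' : codim_ge (base iota) (flatten [seq r' i | i <- enum 'I_m]) (2 * n).
  by apply: critP => //; [lia | move=> i; apply: sz].
have goal k : codim_ge (base iota)
    (flatten [seq r' i | i <- enum 'I_m] ++ r ord0) k ->
    codim_ge (base iota) (flatten [seq r i | i <- enum 'I_m.+1]) k.
  by apply: codim_ge_perm; rewrite flatten_enum_ordS perm_catC.
apply: goal.
have [allw|/existsNP[i /existsNP[k /not_implyP[ik /eqP wik]]]] :=
    pselect (forall i k, i != k -> omit2 (fun l => lin n (r' l)) i k = 0).
  rewrite -[(2 * n).+2]addn0; apply: codim_ge_cat (codim_ge0 _ _).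
  apply: IH => //; last by move=> i; apply: sz.
  (* With two rows in all, the product omitting both is empty, hence 1. *)
  have m1 : m != 1%N.
    apply/negP => /eqP m1; move: (r) w0; rewrite m1 => r1 w1.
    have := w1 ord0 (lift ord0 ord0) isT; rewrite /omit2 big_pred0.
      by move/eqP; rewrite oner_eq0.
    by case=> [[|[|]]].
  by lia.
rewrite -addn2; apply: codim_ge_cat codim_ge' _.
apply: (@annihilator_codim_ge2 _ _ n (m - 2) (omit2 (fun l => lin n (r' l)) i k)) => //.
- by have := ord_neq_gt1 ik; lia.
- exact: omit2_deg_le.
- exact: omit2_Eacl.
- exact: w0'.
Qed.

Hypothesis two_neq0 : 2%:R != 0 :> K.

(* The hypotheses are the leading forms of the equations of [chart_bound]. *)
Lemma limit_bound M N (F : fieldType) (iota : {rmorphism K -> F})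
    (x : seq F) (a : 'I_M -> F) (r : 'I_M -> seq F) :
  crit_bound M N -> ((1 < M)%N -> crit2_bound M N) -> (0 < M <= N)%N ->
  size x = N -> (forall i, size (r i) = N) ->
  let rr l := lin N (r l) in
  (forall k, omit1 rr k = 0) ->
  (forall k, lin N x * (lin N x * lin_omit2 a rr k) = 0) ->
  lin N x * (\sum_i cE N (a i) * lin_omit2 a rr i) = 0 ->
  codim_ge (base iota) (flatten [seq r i | i <- enum 'I_M] ++
                    (x ++ [seq a i | i <- enum 'I_M])) (2 * N).+2.
Proof.
move=> critMN crit2MN /andP[M_gt0 MN] szx szr rr z0 xxy xay.
have two_neq0F : 2%:R != 0 :> F by rewrite -(rmorph_nat iota) fmorph_eq0.
have [allw|/existsNP[i0 /existsNP[k0 /not_implyP[ik0 /eqP w0]]]] :=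
    pselect (forall i k, i != k -> omit2 rr i k = 0).
  rewrite -[(2 * N).+2]addn0; apply: codim_ge_cat (codim_ge0 _ _).
  have M1 : (1 < M)%N.
    rewrite ltn_neqAle M_gt0 andbT; apply: contraTneq isT => M1.
    have := z0 (Ordinal M_gt0); rewrite omit1_ord1 // => /eqP.
    by rewrite oner_eq0.
  exact: crit2MN.
rewrite -addn2; apply: codim_ge_cat; first exact: critMN.
set B := addb _ _; have wB i k : Eacl B (omit2 rr i k) by apply: omit2_Eacl.
(* Three cases: some x^2 w_ik is nonzero, and two linear equations bind a; or all vanish but some x
   w_ik does not, and one condition binds x and one quadratic equation binds a; or all x w_ik
   vanish, and two conditions bind x. *)
pose q i k := lin N x * (lin N x * omit2 rr i k).
have M2 : ((M - 2).+1 < N)%N.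
  by have := ord_neq_gt1 ik0; lia.
have [allq|/existsNP[i /existsNP[k /not_implyP[ik /eqP qik]]]] :=
    pselect (forall i k, i != k -> q i k = 0); last first.
  rewrite -[2%N]add0n; apply: codim_ge_cat (codim_ge0 _ _) _.
  apply: (linear_codim_ge2 (q := q)) ik qik.
  - move=> i' k'; apply: EaclM; first exact: Eacl_lin_addb.
    by apply: EaclM; [apply: Eacl_lin_addb | apply: Eacl_addb].
  - by move=> i' k'; rewrite /q omit2C.
  - move=> k'; rewrite -[RHS](xxy k') /lin_omit2 !mulr_sumr; apply: eq_bigr => i' _.
    by rewrite /q; ring.
have xw0 : codim_ge B x 1.
  apply: (@square_annihilator_codim_ge1 _ two_neq0F _ N (M - 2) (omit2 rr i0 k0)) => //.
    exact: omit2_deg_le.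
  exact: allq.
pose u i k := lin N x * omit2 rr i k.
have [allu|/existsNP[i /existsNP[k /not_implyP[ik /eqP uik]]]] :=
    pselect (forall i k, i != k -> u i k = 0); last first.
  rewrite -[2%N]/(1 + 1)%N; apply: codim_ge_cat xw0 _.
  apply: (quadratic_codim_ge1 (u := u)) ik uik => //.
  - by move=> i' k'; apply: EaclM; [apply: Eacl_lin_addb | apply: Eacl_addb].
  - by move=> i' k'; rewrite /u omit2C.
  - rewrite -[RHS]xay mulr_sumr; apply: eq_bigr => i' _.
    rewrite mulrCA; congr (_ * _); rewrite mulr_sumr; apply: eq_bigr => k' _.
    by rewrite /u omit2C mulrCA.
rewrite -[2%N]addn0; apply: codim_ge_cat (codim_ge0 _ _).
apply: (@annihilator_codim_ge2 _ _ N (M - 2) (omit2 rr i0 k0)) => //.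
  exact: omit2_deg_le.
exact: allu.
Qed.

End Bounds.

(** * The codimension bound *)

Section ColumnMove.
Variable R : comNzRingType.

Definition movehead (T : Type) (x0 : T) j (x : seq T) : seq T :=
  nth x0 x j :: take j x ++ drop j.+1 x.

Lemma perm_movehead (T : eqType) (x0 : T) j (x : seq T) :
  (j < size x)%N -> perm_eq (movehead x0 j x) x.
Proof.
move=> jx; rewrite -[X in perm_eq _ X](cat_take_drop j) (drop_nth x0 jx).
by rewrite /movehead -cat1s perm_catCA.
Qed.

(** A renaming of the generators: the recursive map brings the wanted generator to the front of the
    tail, and [g] then exchanges the two outermost generators. *)
Lemma movehead_morph j n : (j < n)%N ->
  exists2 f : {rmorphism E R n -> E R n},
    (forall c, f (cE n c) = cE n c) &
    (forall x, size x = n -> f (lin n x) = lin n (movehead 0 j x)).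
Proof.
elim: j n => [|j IH] [|n] //.
  move=> _; exists idfun => // x; case: x => //= c x [szx].
  by rewrite drop0.
rewrite ltnS => jn; have [f fc flin] := IH n jn.
case: n jn f fc flin => // n jn f fc flin.
pose g (u : E R n.+2) : E R n.+2 :=
  mkE (mkE (E0 (f (E0 u))) (E0 (f (E1 u)))) (mkE (E1 (f (E0 u))) (E1 (f (E1 u)))).
have g_zmod : zmod_morphism g.
  move=> u v; rewrite /g !(E0B, E1B) !rmorphB !(E0B, E1B).
  by apply: E_eq; rewrite !(E0B, E1B, mkE0, mkE1); apply: E_eq.
have g_monoid : monoid_morphism g.
  split; first by rewrite /g E01 E11 rmorph1 rmorph0 E01 E11.
  move=> u v; rewrite /g !(E0M, E1M) rmorphD !rmorphM !(E0M, E1M, E0D, E1D).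
  by apply: E_eq; rewrite !(E0M, E1M, mkE0, mkE1); apply: E_eq;
     rewrite !(E0M, E1M, E0D, E1D, mkE0, mkE1) //; ring.
pose gz := GRing.isZmodMorphism.Build _ _ g g_zmod.
pose gm := GRing.isMonoidMorphism.Build _ _ g g_monoid.
pose gr : {rmorphism E R n.+2 -> E R n.+2} := HB.pack g gz gm.
exists gr => [c|[|c x] // [szx]].
  have -> : gr (cE n.+2 c) = g (cE n.+2 c) by [].
  by rewrite /g cES mkE0 mkE1 fc rmorph0.
have -> : gr (lin n.+2 (c :: x)) = g (lin n.+2 (c :: x)) by [].
rewrite /g (linS _ (c :: x)) mkE0 mkE1 (flin x szx) fc.
by rewrite !(linS, cES) !(mkE0, mkE1).
Qed.

End ColumnMove.

(** * Weights and leading forms with coefficients in the square-zero algebra *)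

Section WeightedForms.
Variables (K : fieldType) (T : nat) (w : 'I_T -> nat).
Implicit Types (p q : {mpoly K[T]}).

Definition whomog d p : Prop := forall m, p@_m != 0 -> wdeg w m = d.
Definition wlower d p : Prop := forall m, p@_m != 0 -> (wdeg w m < d)%N.

Lemma whomog0 d : whomog d 0.
Proof. by move=> m; rewrite mcoeff0 eqxx. Qed.

Lemma whomogD d p q : whomog d p -> whomog d q -> whomog d (p + q).
Proof.
move=> hp hq m; rewrite mcoeffD; have [p0|/hp//] := eqVneq p@_m 0.
by rewrite p0 add0r; apply: hq.
Qed.

Lemma wlowerD d p q : wlower d p -> wlower d q -> wlower d (p + q).
Proof.
move=> hp hq m; rewrite mcoeffD; have [p0|/hp//] := eqVneq p@_m 0.
by rewrite p0 add0r; apply: hq.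
Qed.

Lemma whomogM d d' p q : whomog d p -> whomog d' q -> whomog (d + d') (p * q).
Proof.
move=> hp hq m; rewrite -mcoeff_msupp => /msuppM_le /allpairsP[[m1 m2] /=].
by rewrite !mcoeff_msupp => -[/hp pm1 /hq qm2 ->]; rewrite wdegD pm1 qm2.
Qed.

Lemma whomog1 : whomog 0 1.
Proof.
move=> m; rewrite mcoeff1; have [->|] := eqVneq m 0%MM; last by rewrite eqxx.
by rewrite /wdeg big1 // => i _; rewrite mnm0E muln0.
Qed.

Lemma whomogX t : whomog (w t) 'X_t.
Proof.
move=> m; rewrite mcoeffX; have [<-|] := eqVneq U_(t)%MM m; last by rewrite eqxx.
rewrite /wdeg (bigD1 t) //= mnm1E eqxx muln1 big1 ?addn0 // => i it.
by rewrite mnm1E eq_sym (negbTE it) muln0.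
Qed.

Lemma whomog_wlower d d' p : (d < d')%N -> whomog d p -> wlower d' p.
Proof. by move=> dd' hp m /hp ->. Qed.

Definition Ewhomog d n (u : E {mpoly K[T]} n) := coefall (whomog d) u.

Lemma EwhomogM d d' n (u v : E {mpoly K[T]} n) :
  Ewhomog d u -> Ewhomog d' v -> Ewhomog (d + d') (u * v).
Proof. by apply: coefallM => p q; [apply: whomogD | apply: whomogM]. Qed.

Lemma Ewhomog_sum d n (I : Type) (r : seq I) (P : pred I) (u : I -> E {mpoly K[T]} n) :
  (forall i, P i -> Ewhomog d (u i)) -> Ewhomog d (\sum_(i <- r | P i) u i).
Proof.
move=> hu; apply: big_ind => //; first by apply: coefall0; apply: whomog0.
by move=> a b; apply: coefallD => p q; apply: whomogD.
Qed.

Lemma Ewhomog_prod d n (I : Type) (r : seq I) (P : pred I) (u : I -> E {mpoly K[T]} n) :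
  (forall i, Ewhomog d (u i)) ->
  Ewhomog (\sum_(i <- r | P i) d) (\prod_(i <- r | P i) u i).
Proof.
move=> hu; elim/big_rec2: _ => [|i D v _ hv]; last exact: EwhomogM.
by rewrite -(rmorph1 (cE n)); apply: coefall_cE; [apply: whomog0 | apply: whomog1].
Qed.

Lemma coefall_impl (R : comNzRingType) (Q Q' : R -> Prop) n (u : E R n) :
  (forall a, Q a -> Q' a) -> coefall Q u -> coefall Q' u.
Proof.
move=> QQ'; elim: n u => [|n IH] u /=; first exact: QQ'.
by case=> u0 u1; split; apply: IH.
Qed.

(** An equation in [E] is one scalar equation per squarefree product of generators, and [u] and [v]
    split each into leading and lower part. *)
Lemma top_form_vanishes (F F' : fieldType) (f : {rmorphism {mpoly K[T]} -> F})
    (g : {rmorphism {mpoly K[T]} -> F'}) :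
  (forall p q d, whomog d p -> wlower d q -> f (p + q) = 0 -> g p = 0) ->
  forall n d (u v : E {mpoly K[T]} n),
    coefall (whomog d) u -> coefall (wlower d) v ->
    emap f (u + v) = 0 -> emap g u = 0.
Proof.
move=> fg; elim=> [|n IH] d u v; first exact: fg.
move=> [u0 u1] [v0 v1] uv; apply: E_eq; rewrite emapS ?mkE0 ?mkE1.
  apply: (IH d _ (E0 v)) => //.
  by have := congr1 (@E0 _ _) uv; rewrite emapS mkE0 E0D.
apply: (IH d _ (E1 v)) => //.
by have := congr1 (@E1 _ _) uv; rewrite emapS mkE1 E1D.
Qed.

End WeightedForms.

Lemma emap_omit1 (R S : comNzRingType) (f : {rmorphism R -> S}) m n
    (rr : 'I_m -> E R n) k :
  emap f (omit1 rr k) = omit1 (fun l => emap f (rr l)) k.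
Proof. exact: rmorph_prod. Qed.

Lemma emap_omit2 (R S : comNzRingType) (f : {rmorphism R -> S}) m n
    (rr : 'I_m -> E R n) i k :
  emap f (omit2 rr i k) = omit2 (fun l => emap f (rr l)) i k.
Proof. exact: rmorph_prod. Qed.

Lemma emap_lin_omit2 (R S : comNzRingType) (f : {rmorphism R -> S}) m n
    (aa : 'I_m -> R) (rr : 'I_m -> E R n) k :
  emap f (lin_omit2 aa rr k) =
  lin_omit2 (fun l => f (aa l)) (fun l => emap f (rr l)) k.
Proof.
rewrite raddf_sum; apply: eq_bigr => i _.
by rewrite [LHS]rmorphM /= emap_cE emap_omit2.
Qed.

Lemma size_flatten_enum (T : Type) m n (r : 'I_m -> seq T) :
  (forall i, size (r i) = n) -> size (flatten [seq r i | i <- enum 'I_m]) = (m * n)%N.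
Proof.
move=> sz; rewrite size_flatten sumnE !big_map.
by rewrite (eq_bigr (fun=> n)) // -enumT big_enum sum_nat_const card_ord.
Qed.

Section Chart.
Variables (K : fieldType) (M N : nat).

(* Coordinates (x, a, r) of the chart where the pivot entry is 1: [x] is the
   rest of the pivot row, [a] the rest of its column, [r] the complement. *)
Definition coord := ('I_N + ('I_M + 'I_M * 'I_N))%type.

Let T := #|{: coord}|.

(* These weights make the product of the rows of [r] the leading form of the
   equation [omit1 r k + x * lin_omit2 a r k = 0]. *)
Definition coord_weight (t : 'I_T) : nat :=
  if enum_val t is inr (inr _) then 3 else 1.

Definition point (R : Type) (zeta : 'I_T -> R) (c : coord) : R := zeta (enum_rank c).

Definition pivot_row (R : Type) (zeta : 'I_T -> R) : seq R :=
  [seq point zeta (inl j) | j <- enum 'I_N].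
Definition pivot_col (R : Type) (zeta : 'I_T -> R) (l : 'I_M) : R :=
  point zeta (inr (inl l)).
Definition other_rows (R : Type) (zeta : 'I_T -> R) (l : 'I_M) : seq R :=
  [seq point zeta (inr (inr (l, j))) | j <- enum 'I_N].
Definition all_coords (R : Type) (zeta : 'I_T -> R) : seq R :=
  flatten [seq other_rows zeta l | l <- enum 'I_M] ++
  (pivot_row zeta ++ [seq pivot_col zeta l | l <- enum 'I_M]).

Lemma all_coords_codim_ge (F : fieldType) (B : F -> Prop) (zeta : 'I_T -> F) k :
  codim_ge B (all_coords zeta) k <-> codim_ge B [seq zeta t | t <- enum 'I_T] k.
Proof.
have szr l : size (other_rows zeta l) = N by rewrite size_map size_enum_ord.
have sz : size (all_coords zeta) = size [seq zeta t | t <- enum 'I_T].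
  rewrite !size_cat (size_flatten_enum szr) !size_map -!enumT !size_enum_ord /T.
  by rewrite !card_sum card_prod !card_ord; lia.
have mem1 : {subset all_coords zeta <= [seq zeta t | t <- enum 'I_T]}.
  move=> y; rewrite !mem_cat => /or3P[/flattenP[s /mapP[l _ ->]]||] /mapP[j _ ->];
  by apply: map_f; rewrite mem_enum.
have mem2 : {subset [seq zeta t | t <- enum 'I_T] <= all_coords zeta}.
  move=> y /mapP[t _ ->]; rewrite -(enum_valK t) !mem_cat.
  case: (enum_val t) => [j|[l|[l j]]].
  - by rewrite (map_f (fun j => point zeta (inl j))) ?mem_enum // orbT.
  - by rewrite (map_f (fun j => point zeta (inr (inl j)))) ?mem_enum // !orbT.
  - apply/orP; left; apply/(mem_flatten_enum (i := l)).
    by rewrite (map_f (fun j => point zeta (inr (inr (l, j))))) ?mem_enum.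
by split; apply: codim_ge_mem; rewrite ?sz.
Qed.

Local Notation gen := (fun t : 'I_T => 'X_t : {mpoly K[T]}).

Lemma map_pivot_row (R S : Type) (f : R -> S) (zeta : 'I_T -> R) :
  [seq f c | c <- pivot_row zeta] = pivot_row (f \o zeta).
Proof. by rewrite -map_comp. Qed.

Lemma map_other_rows (R S : Type) (f : R -> S) (zeta : 'I_T -> R) l :
  [seq f c | c <- other_rows zeta l] = other_rows (f \o zeta) l.
Proof. by rewrite -map_comp. Qed.

Lemma pivot_row_hom n : Ewhomog coord_weight 1 (lin n (pivot_row gen)).
Proof.
apply: coefall_lin => [|c /mapP[j _ ->]]; first exact: whomog0.
have := @whomogX K T coord_weight (enum_rank (inl j : coord)).
by rewrite /coord_weight enum_rankK.
Qed.

Lemma pivot_col_hom n l : Ewhomog coord_weight 1 (cE n (pivot_col gen l)).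
Proof.
apply: coefall_cE; first exact: whomog0.
have := @whomogX K T coord_weight (enum_rank (inr (inl l) : coord)).
by rewrite /coord_weight enum_rankK.
Qed.

Lemma other_rows_hom n l : Ewhomog coord_weight 3 (lin n (other_rows gen l)).
Proof.
apply: coefall_lin => [|c /mapP[j _ ->]]; first exact: whomog0.
have := @whomogX K T coord_weight (enum_rank (inr (inr (l, j)) : coord)).
by rewrite /coord_weight enum_rankK.
Qed.

Let grr l := lin N (other_rows gen l).

Lemma omit1_hom k : Ewhomog coord_weight (M * 3 - 3) (omit1 grr k).
Proof.
have -> : (M * 3 - 3 = \sum_(l < M | l != k) 3)%N.
  have : (\sum_(l < M) 3 = 3 * M)%N by rewrite big_const_ord iter_addn addn0.
  by rewrite (bigD1 k) //= mulnC => <-; rewrite addKn.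
by rewrite /omit1; apply: Ewhomog_prod => l; apply: other_rows_hom.
Qed.

Lemma omit2_hom i k : i != k ->
  exists2 d, (d.+3 = M * 3 - 3)%N & Ewhomog coord_weight d (omit2 grr i k).
Proof.
move=> ik; exists (\sum_(l < M | (l != i) && (l != k)) 3)%N.
  have : (\sum_(l < M) 3 = 3 * M)%N by rewrite big_const_ord iter_addn addn0.
  rewrite (bigD1 i) //= (bigD1 k) /=; last by rewrite eq_sym.
  by rewrite mulnC => <-; rewrite addKn.
by rewrite /omit2; apply: Ewhomog_prod => l; apply: other_rows_hom.
Qed.

Hypothesis two_neq0 : 2%:R != 0 :> K.

(** With weight 3 for the rows, x y_k has weight one less than z_k and drops out of the first
    equation. The other two are already homogeneous, of weight [M * 3 - 3], and pass to the limit
    unchanged. *)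
Lemma chart_bound (F : fieldType) (iota : {rmorphism K -> F}) (xi : 'I_T -> F) :
  crit_bound K M N -> ((1 < M)%N -> crit2_bound K M N) -> (0 < M <= N)%N ->
  let x := lin N (pivot_row xi) in let rr l := lin N (other_rows xi l) in
  let a := pivot_col xi in
  (forall k, omit1 rr k + x * lin_omit2 a rr k = 0) ->
  (forall k, x * (x * lin_omit2 a rr k) = 0) ->
  x * (\sum_i cE N (a i) * lin_omit2 a rr i) = 0 ->
  codim_ge (base iota) (all_coords xi) (2 * N).+2.
Proof.
move=> critMN crit2MN MN x rr a eq1 eq2 eq3; apply/all_coords_codim_ge.
apply: (@degeneration _ _ coord_weight) => [t|F' iota' eta lim].
  by rewrite /coord_weight; case: (enum_val t) => [|[]].
apply/all_coords_codim_ge; apply: limit_bound => //.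
- by rewrite size_map size_enum_ord.
- by move=> l; rewrite size_map size_enum_ord.
all: have top := top_form_vanishes (f := mmap iota xi) (g := mmap iota' eta) lim.
all: have evX (G : fieldType) (ig : {rmorphism K -> G}) (zeta : 'I_T -> G) :
  mmap ig zeta \o gen = zeta by apply/funext => t /=; rewrite mmapX mmap1U.
all: have emx (G : fieldType) (ig : {rmorphism K -> G}) (zeta : 'I_T -> G) :
  emap (mmap ig zeta) (lin N (pivot_row gen)) = lin N (pivot_row zeta)
  by rewrite emap_lin map_pivot_row evX.
all: have emr (G : fieldType) (ig : {rmorphism K -> G}) (zeta : 'I_T -> G) :
  (fun l => emap (mmap ig zeta) (grr l)) = (fun l => lin N (other_rows zeta l))
  by apply/funext => l; rewrite emap_lin map_other_rows evX.
all: have ema (G : fieldType) (ig : {rmorphism K -> G}) (zeta : 'I_T -> G) :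
  (fun l => mmap ig zeta (pivot_col gen l)) = pivot_col zeta
  by apply/funext => l; rewrite [LHS]mmapX mmap1U.
all: have ema1 (G : fieldType) (ig : {rmorphism K -> G}) (zeta : 'I_T -> G) l :
  mmap ig zeta (pivot_col gen l) = pivot_col zeta l by rewrite [LHS]mmapX mmap1U.
all: have wlower0 d n : coefall (wlower coord_weight d) (0 : E {mpoly K[T]} n)
  by apply: coefall0 => m; rewrite mcoeff0 eqxx.
- move=> k; rewrite -(emr _ iota') -emap_omit1.
  apply: (top _ _ _ (lin N (pivot_row gen) * lin_omit2 (pivot_col gen) grr k) (omit1_hom k)).
    rewrite /lin_omit2 mulr_sumr; apply: big_ind => //.
      by move=> u v; apply: coefallD => p q; apply: wlowerD.
    move=> i ik; have [d dE dP] := omit2_hom ik.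
    apply: (coefall_impl (Q := whomog coord_weight (1 + (1 + d)))).
      by move=> p; apply: whomog_wlower; lia.
    by apply: EwhomogM; [apply: pivot_row_hom | apply: EwhomogM => //; apply: pivot_col_hom].
  by rewrite rmorphD rmorphM /= emap_omit1 emap_lin_omit2 emx emr ema.
- move=> k; rewrite -(emr _ iota') -(ema _ iota') -(emx _ iota') -emap_lin_omit2 -!rmorphM.
  apply: (top _ (M * 3 - 3)%N _ 0) => //.
    rewrite /lin_omit2 !mulr_sumr; apply: Ewhomog_sum => i ik.
    have [d <- dP] := omit2_hom ik; apply: (EwhomogM (d := 1) (d' := d.+2)).
      exact: pivot_row_hom.
    apply: (EwhomogM (d := 1) (d' := d.+1)); first exact: pivot_row_hom.
    by apply: (EwhomogM (d := 1)) => //; apply: pivot_col_hom.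
  by rewrite addr0 !rmorphM /= emap_lin_omit2 emx emr ema.
- have -> : lin N (pivot_row eta) * (\sum_i cE N (pivot_col eta i) *
        lin_omit2 (pivot_col eta) (fun l => lin N (other_rows eta l)) i) =
      emap (mmap iota' eta) (lin N (pivot_row gen) *
        (\sum_i cE N (pivot_col gen i) * lin_omit2 (pivot_col gen) grr i)).
    rewrite rmorphM rmorph_sum /= emx; congr (_ * _); apply: eq_bigr => i _.
    rewrite rmorphM /= emap_lin_omit2 emr ema emap_cE; congr (cE N _ * _).
    exact/esym/ema1.
  apply: (top _ (M * 3 - 3)%N _ 0) => //.
    rewrite mulr_sumr; apply: Ewhomog_sum => i _.
    rewrite /lin_omit2 !mulr_sumr; apply: Ewhomog_sum => k ki.
    have [d <- dP] := omit2_hom ki; apply: (EwhomogM (d := 1) (d' := d.+2)).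
      exact: pivot_row_hom.
    apply: (EwhomogM (d := 1) (d' := d.+1)); first exact: pivot_col_hom.
    by apply: (EwhomogM (d := 1)) => //; apply: pivot_col_hom.
  rewrite addr0 rmorphM rmorph_sum /= emx -[RHS]eq3; congr (_ * _).
  apply: eq_bigr => i _.
  rewrite rmorphM /= emap_lin_omit2 emr ema emap_cE; congr (cE N _ * _).
  exact: ema1.
Qed.

End Chart.

Lemma map_nth_enum (T : Type) (x0 : T) N (x : seq T) : size x = N ->
  [seq nth x0 x j | j : 'I_N <- enum 'I_N] = x.
Proof.
move=> szx; rewrite -[RHS](mkseq_nth x0) /mkseq szx -val_enum_ord -map_comp.
exact: eq_map.
Qed.

Lemma point_surj (T : Type) (x0 : T) M N (x : seq T) (a : 'I_M -> T) (r : 'I_M -> seq T) :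
  size x = N -> (forall l, size (r l) = N) ->
  exists xi : 'I_#|{: coord M N}| -> T,
    [/\ pivot_row xi = x, pivot_col xi = a & other_rows xi = r].
Proof.
move=> szx szr; pose f (c : coord M N) := match c with
  | inl j => nth x0 x j
  | inr (inl l) => a l
  | inr (inr (l, j)) => nth x0 (r l) j
  end.
exists (f \o enum_val); split.
- rewrite -[RHS](map_nth_enum x0 szx); apply: eq_map => j.
  by rewrite /point /= enum_rankK.
- by apply/funext => l; rewrite /pivot_col /point /= enum_rankK.
- apply/funext => l; rewrite -[RHS](map_nth_enum x0 (szr l)); apply: eq_map => j.
  by rewrite /point /= enum_rankK.
Qed.

Section CriticalLocusBound.
Variable K : fieldType.
Hypothesis two_neq0 : 2%:R != 0 :> K.

(** Let u = e + x be the scaled pivot row. The components of [u * omit1 v k = 0] are x z_k = 0 and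
    z_k + x y_k = 0; the equation omitting the pivot row has e-component sum a_i z_i = 0.
    Substituting z_k = - x y_k in the first and third gives x^2 y_k = 0 and x (sum a_i y_i) = 0. *)
Lemma crit_bound_pivot M N (F : fieldType) (iota : {rmorphism K -> F})
    (p : 'I_M.+1) (b : 'I_M.+1 -> F) (s : 'I_M.+1 -> seq F) :
  crit_bound K M N -> ((1 < M)%N -> crit2_bound K M N) -> (0 < M <= N)%N ->
  (forall i, size (s i) = N) ->
  (forall i, omit1 (fun l => lin N.+1 (b l :: s l)) i = 0) -> b p != 0 ->
  codim_ge (base iota) (flatten [seq b i :: s i | i <- enum 'I_M.+1]) (2 * N.+1).
Proof.
move=> critMN crit2MN MN szs omit0 bp.
pose x := [seq (b p)^-1 * z | z <- s p].
have szx : size x = N by rewrite size_map.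
pose a l := b (lift p l); pose r l := s (lift p l).
have [xi [xiE aE rE]] := @point_surj _ 0 M N x a r szx (fun l => szs _).
pose u : E F N.+1 := mkE (lin N x) 1.
have uE : lin N.+1 (b p :: s p) = cE N.+1 (b p) * u.
  have -> : u = lin N.+1 (1 :: x) by rewrite linS /= rmorph1.
  rewrite -lin_scale /= mulr1 -map_comp; congr (mkE (lin N _) _).
  by rewrite -[LHS]map_id; apply: eq_map => z /=; rewrite mulVKf.
pose rr l := lin N (r l); pose v l := lin N.+1 (a l :: r l).
have omit1_lift k : omit1 (fun l => lin N.+1 (b l :: s l)) (lift p k) =
    lin N.+1 (b p :: s p) * omit1 v k.
  rewrite /omit1 (bigD1 p) ?neq_lift // big_andbC prod_lift; congr (_ * _).
  by apply: eq_bigl => l; rewrite (inj_eq lift_inj).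
have uv k : u * omit1 v k = 0.
  have := omit0 (lift p k); rewrite omit1_lift uE -mulrA.
  move=> /(congr1 (fun z => cE N.+1 (b p)^-1 * z)).
  by rewrite mulrA mulr0 -rmorphM mulVf // rmorph1 mul1r.
have vv : \prod_l v l = 0.
  rewrite -[RHS](omit0 p) /omit1.
  have <- := prod_lift p predT (fun l => lin N.+1 (b l :: s l)).
  by apply: eq_bigl => l; rewrite andbT.
have E0omit k : E0 (omit1 v k) = omit1 rr k by rewrite [LHS]rmorph_prod.
have E1omit k : E1 (omit1 v k) = lin_omit2 a rr k.
  rewrite E1_prod; apply: eq_bigr => i _; congr (_ * _).
  by rewrite /omit2 big_andbC.
have eq0 k : lin N x * omit1 rr k = 0.
  by have := congr1 (@E0 _ _) (uv k); rewrite E0M E0omit.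
have eq1 k : omit1 rr k + lin N x * lin_omit2 a rr k = 0.
  have := congr1 (@E1 _ _) (uv k); rewrite E1M E0omit E1omit mkE0 mkE1 mul1r.
  by rewrite addrC.
have eq3 : \sum_i cE N (a i) * omit1 rr i = 0.
  have := congr1 (@E1 _ _) vv; rewrite E1_prod E10 => E; rewrite -[RHS]E.
  by apply: eq_bigr => i _; congr (_ * _).
have [|||t szt tP] := @chart_bound _ M N two_neq0 _ iota xi critMN crit2MN MN.
- move=> k; rewrite xiE aE rE; exact: eq1.
- move=> k; rewrite xiE aE rE; have /eqP := eq1 k; rewrite addrC addr_eq0 => /eqP->.
  by rewrite mulrN eq0 oppr0.
- rewrite xiE aE rE mulr_sumr -[RHS]oppr0 -[in RHS]eq3 -sumrN; apply: eq_bigr => i _.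
  by rewrite mulrCA -mulrN; congr (_ * _); apply/eqP; rewrite -addr_eq0 addrC eq1.
have szall : size (all_coords xi) = (M * N + (N + M))%N.
  rewrite !size_cat (size_flatten_enum (n := N)) => [|l].
    by rewrite !size_map -!enumT !size_enum_ord.
  by rewrite size_map size_enum_ord.
(* The pivot is one more coordinate and one more generator, so the codimension [2 * N + 2] is
   unchanged; multiplication by the pivot recovers its row from [x]. *)
exists (b p :: t).
  rewrite (size_flatten_enum (n := N.+1)) => [|i] /=; last by rewrite szs.
  by move: szt; rewrite szall; lia.
have acl_t y : y \in all_coords xi -> acl (addb (base iota) (b p :: t)) y.
  by move/tP; apply: acl_addb_sub => z zt; rewrite inE zt orbT.
have acl_bp : acl (addb (base iota) (b p :: t)) (b p) by apply/acl_mem/mem_head.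
move=> y /flattenP[_ /mapP[i _ ->]].
case: (unliftP p i) => [l ->|->]; rewrite inE => /orP[/eqP->//|ys].
- apply: acl_t; rewrite !mem_cat; apply/or3P/Or33.
  by rewrite aE; apply/map_f; rewrite mem_enum.
- apply: acl_t; rewrite mem_cat; apply/orP; left; rewrite rE.
  exact: (@mem_flatten_enum _ _ _ l).
- rewrite -[y](mulVKf bp); apply: aclM => //; apply: acl_t.
  rewrite !mem_cat; apply/or3P/Or32; rewrite xiE.
  exact: map_f.
Qed.

Lemma crit_boundP n : forall m, (0 < m <= n)%N -> crit_bound K m n.
Proof.
elim: n => [|N IH] [|M] // MN F iota r szr omit0.
(* The product omitting the row of a one-row matrix is 1. Having at least two rows, the zero matrix
   has codimension at least [2 * N.+1]. *)
have M_gt0 : (0 < M)%N.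
  rewrite lt0n; apply/eqP => M0; have := omit0 ord0.
  by rewrite omit1_ord1 ?M0 // => /eqP; rewrite oner_eq0.
have [nz|/existsNP[p /existsNP[c /not_implyP[cp /eqP c0]]]] :=
    pselect (forall i c, c \in r i -> c = 0).
  exists [::]; first by rewrite (size_flatten_enum szr) leq_mul2r; apply/orP; right.
  by move=> y /flattenP[_ /mapP[i _ ->]] /nz ->; apply: acl0.
set j := index c (r p).
have jN : (j < N.+1)%N by rewrite -(szr p) index_mem.
have [f fc flin] := movehead_morph F jN.
pose b i := nth 0 (r i) j; pose s i := take j (r i) ++ drop j.+1 (r i).
have permr i : perm_eq (b i :: s i) (r i) by apply: perm_movehead; rewrite szr.
have szs i : size (s i) = N by have := perm_size (permr i); rewrite szr => -[].
have MN' : (0 < M <= N)%N by rewrite M_gt0.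
have bp : b p != 0 by rewrite /b nth_index.
have omit0' i : omit1 (fun l => lin N.+1 (b l :: s l)) i = 0.
  rewrite -(rmorph0 f) -(omit0 i) [in RHS]rmorph_prod; apply: eq_bigr => l _.
  by rewrite flin.
have crit2 : (1 < M)%N -> crit2_bound K M N.
  by move=> M1; apply: crit2_bound_of => //; rewrite M1.
have := crit_bound_pivot iota (IH M MN') crit2 MN' szs omit0' bp.
apply: codim_ge_mem.
  by rewrite (size_flatten_enum szr) (size_flatten_enum (n := N.+1)) // => i; rewrite /= szs.
move=> y /flattenP[_ /mapP[i _ ->]]; rewrite -(perm_mem (permr i)).
exact: (@mem_flatten_enum _ _ (fun i => b i :: s i)).
Qed.

End CriticalLocusBound.

(** * Krull dimension *)

Lemma rcl_sub (R : nzRingType) (B B' : R -> Prop) z :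
  (forall x, B x -> B' x) -> rcl B z -> rcl B' z.
Proof.
move=> BB'; elim=> {z}[x /BB' Bx||x y _ ? _ ?|x y _ ? _ ?].
- exact: rcl_in.
- exact: rcl1.
- exact: rclB.
- exact: rclM.
Qed.

Lemma rcl_horner (R : comNzRingType) (B : R -> Prop) g q :
  rcl (fun x => B x \/ x = g) q ->
  exists2 h : {poly R}, (forall i, rcl B h`_i) & q = h.[g].
Proof.
elim=> {q}[x [Bx|->]||_ _ _ [p Bp ->] _ [q Bq ->]|_ _ _ [p Bp ->] _ [q Bq ->]].
- exists x%:P; last by rewrite hornerC.
  by move=> i; rewrite coefC; case: ifP => _; [apply: rcl_in | apply: rcl0].
- exists 'X; last by rewrite hornerX.
  by move=> i; rewrite coefX; case: eqP => _; [apply: rcl1 | apply: rcl0].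
- exists 1; last by rewrite hornerC.
  by move=> i; rewrite coef1; case: eqP => _; [apply: rcl1 | apply: rcl0].
- exists (p - q); last by rewrite !hornerE.
  by move=> i; rewrite coefB; apply: rclB.
- exists (p * q); last by rewrite hornerM.
  move=> i; rewrite coefM; apply: big_ind => [||j _]; first exact: rcl0.
    exact: rclD.
  exact: rclM.
Qed.

Section KrullDimension.
Variables (k : closedFieldType) (N : nat).
Implicit Types (Y Z : set 'rV[k]_N) (p q : {mpoly k[N]}) (U : {set 'I_N}).

Definition vanishing Z p : Prop := forall v, Z v -> p.@[v 0] = 0.

Lemma vanishing_prime Z : zariski_irreducible Z -> prime_pred (vanishing Z).
Proof.
move=> [[v0 Zv0] Zirr]; split; [split| |].
- by move=> v _; rewrite meval0.
- by move=> p q Zp Zq v Zv; rewrite mevalD Zp // Zq // addr0.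
- by move=> p q Zq v Zv; rewrite mevalM Zq // mulr0.
- by move/(_ _ Zv0)/eqP; rewrite meval1 oner_eq0.
- move=> p q Zpq; pose V r := zero_locus (fun r' : {mpoly k[N]} => r' = r).
  have [||v Zv|VZ|VZ] := Zirr (V p) (V q).
  + by exists (fun r' => r' = p).
  + by exists (fun r' => r' = q).
  + have /eqP := Zpq v Zv; rewrite mevalM mulf_eq0.
    by case/orP => /eqP E; [left | right] => _ ->.
  + by left=> v /VZ; apply.
  + by right=> v /VZ; apply.
Qed.

Lemma closed_separating Y Z : zariski_closed Y -> (Y `<` Z)%classic ->
  exists2 p, vanishing Y p & ~ vanishing Z p.
Proof.
move=> [S ->] [_ nZY]; apply: contrapT => nop; apply: nZY => v Zv p Sp.
apply: contrapT => pv; apply: nop; exists p => [u Yu|]; first exact: Yu.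
by move/(_ v Zv).
Qed.

Definition generic_codim_ge Z c : Prop :=
  forall (F : fieldType) (iota : {rmorphism k -> F}) (xi : 'I_N -> F),
    (forall p, vanishing Z p -> mmap iota xi p = 0) ->
    codim_ge (base iota) [seq xi i | i <- enum 'I_N] c.

(* Separating polynomials for consecutive members of the chain are
   algebraically independent at the generic point of its largest member. *)
Lemma chain_length_bound Z c l (Y : 'I_l.+1 -> set 'rV[k]_N) :
  generic_codim_ge Z c -> irreducible_chain Z Y -> (l + c <= N)%N.
Proof.
move=> Zc [YP Ylt].
pose P j := vanishing (Y (inord j)).
have Pprime j : prime_pred (P j) by apply: vanishing_prime; case: (YP (inord j)).
have Psub i j p : (i <= j <= l)%N -> P j p -> P i p.
  case/andP; rewrite leq_eqVlt => /orP[/eqP->//|lt_ij] jl Pjp v Yv; apply: Pjp.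
  have : ((inord i : 'I_l.+1) < (inord j : 'I_l.+1))%N by rewrite !inordK //; lia.
  by move/Ylt => [Yij _]; apply: Yij.
have /choice[g gP] j : exists g, (j < l)%N -> P j g /\ ~ P j.+1 g.
  have [jl|] := ltnP j l; last by exists 0.
  have [||g g1 g2] := @closed_separating (Y (inord j)) (Y (inord j.+1)).
  - by case: (YP (inord j)).
  - by apply: Ylt; rewrite !inordK //; lia.
  - by exists g.
pose A j q := (exists c, q = c%:MP) \/ exists2 i, (i < j)%N & q = g i.
have AS j q : A j.+1 q -> A j q \/ q = g j.
  case=> [cq|[i]]; first by left; left.
  by rewrite ltnS leq_eqVlt => /orP[/eqP->|ij]; [right | left; right; exists i].
(* Induction on [h]: on the smaller set [g j] vanishes, so the constant coefficient of [h] vanishes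
   there and is zero by independence; on the larger set the remaining factor [g j] can be cancelled
   by primality. *)
have indep_step j : (j < l)%N -> (forall q, rcl (A j) q -> P j q -> q = 0) ->
    forall h : {poly {mpoly k[N]}}, (forall i, rcl (A j) h`_i) ->
    P j.+1 h.[g j] -> h = 0.
  move=> jl indep_j; have [Pg nPg] := gP j jl.
  elim/poly_ind => // h a IH hA; rewrite hornerMXaddC => Ph.
  have [[[_ PD PM] _ _] [[P0' _ PM'] _ Pp]] := (Pprime j, Pprime j.+1).
  have a0 : a = 0.
    apply: indep_j; first by have := hA 0%N; rewrite coefD coefMX coefC add0r.
    have := Psub j j.+1 _ _ Ph; rewrite leqnSn jl => /(_ isT) Ph'.
    have -> : a = (h.[g j] * g j + a) + (- h.[g j]) * g j by ring.
    by apply: (PD) => //; apply: PM.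
  move: Ph; rewrite a0 addr0 => /Pp[Ph|//]; rewrite IH ?mul0r ?add0r //.
  by move=> i; have := hA i.+1; rewrite coefD coefMX coefC addr0.
have indep j : (j <= l)%N -> forall q, rcl (A j) q -> P j q -> q = 0.
  elim: j => [|j IH] jl q Aq Pq.
    have [a aE] : exists a, q = a%:MP.
      elim: Aq {Pq} => {q}[q [//|[]//]||_ _ _ [a ->] _ [b ->]|_ _ _ [a ->] _ [b ->]].
      - by exists 1.
      - by exists (a - b); rewrite mpolyCB.
      - by exists (a * b); rewrite mpolyCM.
    have [_ [[v Yv] _] _] := YP (inord 0).
    by have := Pq v Yv; rewrite aE mevalC => ->; rewrite mpolyC0.
  have [h hA qE] := rcl_horner (rcl_sub (@AS j) Aq).
  rewrite qE (_ : h = 0) ?horner0 //; apply: (indep_step j jl _ h hA).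
    by apply: IH; apply: ltnW.
  by rewrite -qE.
have [F [f fP]] := prime_pred_field (Pprime l).
pose iota : {rmorphism k -> F} := f \o @mpolyC N k.
pose xi i := f 'X_i.
have evE p : mmap iota xi p = f p by exact: mmap_morph.
have [|t szt tP] := Zc F iota xi.
  move=> p Zp; rewrite evE; apply/fP => v Yv; apply: Zp.
  by have [_ _ YZ] := YP (inord l); apply: YZ.
move: szt; rewrite size_map size_enum_ord; apply: leq_trans; rewrite leq_add2r.
have ft p : acl (addb (base iota) t) (f p).
  have pT : supp_in [set: 'I_N]%SET p by move=> m _ i; rewrite inE.
  rewrite -evE; apply: acl_trans (acl_ev iota xi pT) => x; case=> [Bx|/mapP[i _ ->]].
    by apply: acl_in; left.
  by apply: tP; rewrite map_f // mem_enum.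
pose gs i n := [seq f (g j) | j <- seq.iota i n].
have gs_indep n i B : (i + n <= l)%N ->
    (forall x, B x -> acl (addb (base iota) (gs 0%N i)) x) -> acl_indep B (gs i n).
  elim: n i B => // n IH i B il BP /=; split.
    move=> /(acl_trans BP)/acl_alg[p [p0 pP /rootP proot]].
    have /choice[h hP] j : exists h, rcl (A i) h /\ p`_j = f h.
      have [|h Ah ph] := @rcl_map _ _ f (A i) p`_j; last by exists h.
      apply: rcl_sub (pP j) => x [[a ->]|/mapP[i']].
        by exists a%:MP => //; left; exists a.
      rewrite mem_iota add0n => /andP[_ i'i] ->; exists (g i') => //.
      by right; exists i'.
    pose H := \poly_(j < size p) h j.
    have HA j : rcl (A i) H`_j.
      by rewrite coef_poly; case: ifP => _; [case: (hP j) | apply: rcl0].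
    have H0 : H = 0.
      apply: (indep_step i) HA _; [lia | by apply: indep; lia |].
      apply: (Psub _ l); first lia.
      apply/fP; rewrite horner_poly rmorph_sum /= -[RHS]proot horner_coef.
      by apply: eq_bigr => j _; rewrite rmorphM rmorphXn; case: (hP j) => _ ->.
    case/eqP: p0; apply/polyP => j; rewrite coef0.
    have [jp|jp] := ltnP j (size p); last by rewrite nth_default.
    have [_ ->] := hP j; have := congr1 (fun q : {poly _} => q`_j) H0.
    by rewrite coef_poly jp coef0 => ->; rewrite rmorph0.
  apply: IH; first by rewrite addSnnS.
  have gsS : gs 0%N i.+1 = gs 0%N i ++ [:: f (g i)].
    by rewrite /gs -addn1 iotaD map_cat.
  move=> x [/BP|xg]; last by apply: acl_mem; rewrite gsS mem_cat xg orbT.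
  by apply: acl_addb_sub => y yg; rewrite gsS mem_cat yg.
have gs_l : acl_indep (base iota) (gs 0%N l).
  by apply: gs_indep => // x Bx; apply: acl_in; left.
rewrite -[l](size_iota 0) -(size_map (fun j => f (g j))).
by apply: steinitz gs_l _ => x /mapP[j _ ->].
Qed.

Definition coord_space U : set 'rV[k]_N :=
  fun v => forall i, i \notin U -> v 0 i = 0.

Lemma coord_space_closed U : zariski_closed (coord_space U).
Proof.
exists (fun p => exists2 i, i \notin U & p = 'X_i).
apply/seteqP; split=> v Uv.
  by move=> _ [i iU ->]; rewrite mevalXU; apply: Uv.
by move=> i iU; rewrite -(mevalXU (v 0) i); apply: Uv; exists i.
Qed.

(* Restricting to the line through two points where [p] and [q] do not vanish. *)
Lemma coord_space_irreducible U : zariski_irreducible (coord_space U).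
Proof.
split; first by exists 0 => i _; rewrite mxE.
move=> _ _ [S ->] [S' ->] UAB; apply: contrapT => /not_orP[nA nB]; move: nA nB.
have escape S0 : ~ (coord_space U `<=` zero_locus S0)%classic ->
    exists p u, [/\ S0 p, coord_space U u & p.@[u 0] != 0].
  move=> nS0; apply: contrapT => nex; apply: nS0 => u Uu p Sp.
  by apply/eqP; apply: contrapT => /negP pu; apply: nex; exists p, u.
move=> /escape[p [u [Sp Uu pu]]] /escape[q [v [Sq Uv qv]]].
pose line i : {poly k} := (u 0 i)%:P + 'X * (v 0 i - u 0 i)%:P.
pose restrict r : {poly k} := mmap (@polyC k) line r.
have restrictE r t : (restrict r).[t] = r.@[(u + t *: (v - u)) 0].
  rewrite /restrict /meval /mmap horner_sum; apply: eq_bigr => m _.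
  rewrite hornerM hornerC /= horner_prod; congr (_ * _); apply: eq_bigr => i _.
  by rewrite horner_exp !hornerE !mxE.
have pq0 : restrict p * restrict q != 0.
  apply: mulf_neq0.
    apply: contraNneq pu => p0.
    by have := restrictE p 0; rewrite p0 horner0 scale0r addr0 => <-.
  apply: contraNneq qv => q0.
  by have := restrictE q 1; rewrite q0 horner0 scale1r addrC subrK => <-.
have [t pqt] : exists t, ~~ root (restrict p * restrict q) t.
  exact: closed_nonrootP pq0.
case/negP: pqt; rewrite rootE hornerM !restrictE mulf_eq0.
have Uw : coord_space U (u + t *: (v - u)).
  by move=> i iU; rewrite !mxE Uu // Uv // subr0 mulr0 addr0.
by case: (UAB _ Uw) => Sw; rewrite ?(Sw p Sp) ?(Sw q Sq) eqxx ?orbT.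
Qed.

Lemma coord_space_chain U Z : (coord_space U `<=` Z)%classic ->
  exists Y : 'I_#|U|.+1 -> set 'rV[k]_N, irreducible_chain Z Y.
Proof.
move=> UZ; pose V i := [set x in take i (enum U)]%SET.
have VU i : V i \subset U.
  by apply/fintype.subsetP => x; rewrite inE => /mem_take; rewrite mem_enum.
exists (fun i => coord_space (V i)); split.
  move=> i; split; [exact: coord_space_closed|exact: coord_space_irreducible|].
  move=> v Vv; apply: UZ => j jU; apply: Vv; apply: contra jU.
  by move/fintype.subsetP: (VU i); apply.
move=> i j ij; split.
  move=> v Vv x xV; apply: Vv; apply: contra xV; rewrite !inE.
  by move=> xi; rewrite -(cat_take_drop i (take j _)) mem_cat take_takel ?xi // ltnW.
have iU : (i < size (enum U))%N by rewrite -cardE (leq_trans ij) // -ltnS.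
have [x0 _] : exists x : 'I_N, true by case: (enum U) iU => // x *; exists x.
set x := nth x0 (enum U) i.
(* The unit vector at this element of [U] lies in the larger subspace but not in the smaller. *)
move/(_ (delta_mx 0 x)) => VV.
suff : (delta_mx 0 x : 'rV[k]_N) 0 x = 0.
  by move/eqP; rewrite mxE !eqxx oner_eq0.
apply: VV.
  move=> y yV; rewrite mxE eqxx /=; case: eqP => // yx; case/negP: yV.
  rewrite inE yx /x -(nth_take x0 ij) mem_nth // size_take_min leq_min ij.
  by rewrite iU.
rewrite inE /x; apply/negP => /(nthP x0)[y]; rewrite size_take iU => yi.
rewrite nth_take // => /eqP; rewrite nth_uniq ?enum_uniq //.
  by rewrite ltn_eqF.
exact: ltn_trans iU.
Qed.

Lemma coord_space_has_dim U Z : (coord_space U `<=` Z)%classic ->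
  generic_codim_ge Z (N - #|U|) -> has_dim Z #|U|.
Proof.
move=> UZ Zc; split; first exact: coord_space_chain.
move=> l Y /(chain_length_bound Zc); have := max_card (mem U).
by rewrite card_ord; lia.
Qed.

Lemma has_dim_affine : has_dim (setT : set 'rV[k]_N) N.
Proof.
have NT : #|[set: 'I_N]%SET| = N by rewrite cardsT card_ord.
have : has_dim (setT : set 'rV[k]_N) #|[set: 'I_N]%SET|.
  apply: coord_space_has_dim => // F iota xi _.
  by rewrite NT subnn; apply: codim_ge0.
by rewrite NT.
Qed.

End KrullDimension.

(** * The critical locus of the permanent *)

Section PermanentsAsProducts.
Variable R : comNzRingType.

Fixpoint gen_e n (j : nat) : E R n :=
  if n is n'.+1 then
    if j is j'.+1 then mkE (gen_e n' j') 0 else mkE 0 1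
  else 0.

Lemma gen_e_square n j : gen_e n j * gen_e n j = 0.
Proof.
elim: n j => [|n IH] [|j]; rewrite ?mulr0 //; apply: E_eq.
- by rewrite E0M mkE0 mulr0.
- by rewrite E1M mkE0 mkE1 mul0r mulr0 addr0.
- by rewrite E0M mkE0 IH.
- by rewrite E1M mkE1 mulr0 mul0r addr0.
Qed.

Lemma lin_expand n (x : 'I_n -> R) :
  lin n [seq x j | j <- enum 'I_n] = \sum_j cE n (x j) * gen_e n j.
Proof.
elim: n x => [|n IH] x; first by rewrite big_ord0.
rewrite enum_ordSl /= -map_comp big_ord_recl IH; apply: E_eq.
  rewrite E0D E0M !mkE0 mulr0 add0r.
  transitivity (\sum_(j < n) E0 (cE n.+1 (x (lift ord0 j)) * gen_e n.+1 (lift ord0 j)));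
    last by rewrite [RHS]raddf_sum.
  by apply: eq_bigr => j _; rewrite E0M.
rewrite E1D E1M !mkE0 !mkE1 mulr1 mulr0 addr0.
transitivity (cE n (x ord0) +
  \sum_(j < n) E1 (cE n.+1 (x (lift ord0 j)) * gen_e n.+1 (lift ord0 j)));
  last by congr (_ + _); rewrite [RHS]raddf_sum.
rewrite big1 ?addr0 // => j _; rewrite E1M cES mkE1 mul0r addr0.
exact: mulr0.
Qed.

(** Only multiples of the product of all generators are killed by every generator; the degree bound
    excludes them. *)
Lemma gen_e_faithful n d (v : E R n) :
  deg_le d v -> (d < n)%N -> (forall j, (j < n)%N -> gen_e n j * v = 0) -> v = 0.
Proof.
elim: n d v => // n IH d v [v0 v1] dn ev.
have v0E : E0 v = 0.
  by have := congr1 (@E1 _ _) (ev 0%N isT); rewrite E1M mkE0 mkE1 mul0r mul1r add0r.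
apply: E_eq; first by rewrite v0E.
case: d v0 v1 dn => [|d] _ v1 dn; first exact: v1.
apply: (IH d _ v1) => // j jn.
by have := congr1 (@E1 _ _) (ev j.+1 jn); rewrite E1M mkE0 mkE1 mul0r addr0.
Qed.

(** Squares of generators vanish, so only injective choices of columns survive the expansion. *)
Lemma prod_lin_perm n (A : 'I_n -> 'I_n -> R) :
  \prod_l lin n [seq A l j | j <- enum 'I_n] =
  cE n (\sum_(s : 'S_n) \prod_l A l (s l)) * \prod_(l < n) gen_e n l.
Proof.
under eq_bigr do rewrite lin_expand.
rewrite bigA_distr_bigA (bigID (fun f : {ffun 'I_n -> 'I_n} => injectiveb f)) /= addrC.
rewrite big1 ?add0r => [|f /injectivePn[l1 [l2 neq_l eq_f]]]; last first.
  rewrite (bigD1 l1) //= (bigD1 l2) 1?eq_sym //= mulrA eq_f.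
  by rewrite mulrACA gen_e_square mulr0 mul0r.
rewrite (reindex (@pval _)) /=; last first.
  pose in_Sn := insubd (1%g : 'S_n).
  by exists in_Sn => /= f Uf; first apply: val_inj; apply: insubdK.
rewrite rmorph_sum mulr_suml; apply: eq_big => [s|s _] /=; first exact: (valP s).
rewrite pvalE big_split /= rmorph_prod; congr (_ * _).
by rewrite [RHS](reindex_inj (@perm_inj _ s)).
Qed.

(** The omitted product has degree below [n], so it suffices to kill it by each generator.
    Multiplying by the [j]-th one puts a unit vector in row [i], and the permanent of that matrix is
    the given subpermanent. *)
Lemma omit1_of_permanents n (A : 'I_n -> 'I_n -> R) i :
  (forall j, \sum_(s : 'S_n | s i == j) \prod_(l | l != i) A l (s l) = 0) ->
  omit1 (fun l => lin n [seq A l j | j <- enum 'I_n]) i = 0.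
Proof.
move=> A0; apply: (@gen_e_faithful _ n.-1).
- have := deg_le_prod (fun l => l != i)
    (fun l => deg_le_lin n [seq A l j | j <- enum 'I_n]).
  by rewrite cardC1 card_ord.
- by rewrite prednK //; apply: leq_ltn_trans (ltn_ord i).
move=> j jn; pose B l j' := if l == i then (j' == Ordinal jn)%:R else A l j'.
have -> : gen_e n j = lin n [seq B i j' | j' <- enum 'I_n].
  rewrite lin_expand (bigD1 (Ordinal jn)) //= /B !eqxx rmorph1 mul1r.
  rewrite big1 ?addr0 // => j' /negbTE->; by rewrite rmorph0 mul0r.
transitivity (\prod_l lin n [seq B l j' | j' <- enum 'I_n]).
  rewrite (bigD1 i) //=; congr (_ * _); apply: eq_bigr => l /negbTE li.
  by congr lin; apply: eq_map => j'; rewrite /B li.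
rewrite prod_lin_perm (_ : \sum_(s : 'S_n) _ = 0) ?rmorph0 ?mul0r //.
rewrite -[RHS](A0 (Ordinal jn)) [RHS]big_mkcond; apply: eq_bigr => s _.
rewrite (bigD1 i) //= /B eqxx; case: eqP => _; rewrite ?mul1r ?mul0r //.
by apply: eq_bigr => l /negbTE->.
Qed.

End PermanentsAsProducts.

Lemma mxvec_index_inj m n (i i' : 'I_m) (j j' : 'I_n) :
  mxvec_index i j = mxvec_index i' j' -> i = i' /\ j = j'.
Proof.
have [g gK _] := curry_mxvec_bij m n.
move=> E; have := congr1 g E.
by rewrite -!/(uncurry (@mxvec_index m n) (_, _)) !gK // => -[-> ->].
Qed.

Lemma per_deriv (R : comNzRingType) n (i j : 'I_n) :
  (per R n)^`M(mxvec_index i j) =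
  \sum_(s : 'S_n | s i == j) \prod_(l | l != i) 'X_(mxvec_index l (s l)).
Proof.
rewrite /per /permanent raddf_sum [RHS]big_mkcond; apply: eq_bigr => s _ /=.
rewrite (bigD1 i) //= mderivM mxE.
have derX l j' : ('X_(mxvec_index l j') : {mpoly R[n * n]})^`M(mxvec_index i j) =
    ((l == i) && (j' == j))%:R.
  rewrite mderivX mnm1E; case: eqP => [/mxvec_index_inj[-> ->]|ne].
    rewrite !eqxx scale1r -mpolyX0; congr mpolyX; apply/mnmP => t.
    by rewrite mnmBE subnn mnm0E.
  rewrite scale0r; case: eqP => // li; case: eqP => // jj.
  by case: ne; rewrite li jj.
rewrite derX eqxx /= [X in _ + _ * X](_ : _ = 0) ?mulr0 ?addr0; last first.
  elim/big_ind: _ => [|x y x0 y0|l li].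
  - by rewrite -mpolyC1 mderivC.
  - by rewrite mderivM x0 y0 mul0r mulr0 addr0.
  - by rewrite mxE derX (negbTE li).
case: eqP => _; rewrite ?mul0r // mul1r; apply: eq_bigr => l _.
by rewrite mxE.
Qed.

Section Transfer.
Variables (K k : fieldType) (g : {rmorphism K -> k}) (N : nat).

Lemma mmap_map_mpoly (F : fieldType) (f : {rmorphism k -> F}) (xi : 'I_N -> F)
    (p : {mpoly K[N]}) :
  mmap f xi (map_mpoly g p) = mmap (f \o g) xi p.
Proof.
rewrite /map_mpoly [X in mmap f xi X]/mmap rmorph_sum; apply: eq_bigr => m _.
by rewrite rmorphM /= mmapC mmap1_id mmapX.
Qed.

Lemma meval_map_mpoly (v : 'I_N -> k) (p : {mpoly K[N]}) :
  (map_mpoly g p).@[v] = mmap g v p.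
Proof.
rewrite /map_mpoly [X in X.@[v]]/mmap rmorph_sum; apply: eq_bigr => m _.
by rewrite rmorphM /= mevalC mmap1_id mevalX.
Qed.

End Transfer.

Section CriticalLocus.
Variables (K : fieldType) (k : closedFieldType) (g : {rmorphism K -> k}) (n : nat).

Lemma crit_generic_codim_ge : (0 < n)%N -> 2%:R != 0 :> k ->
  generic_codim_ge (crit_locus g (per K n)) (2 * n).
Proof.
move=> n0 two_neq0 F iota xi xiP.
pose A (i j : 'I_n) := xi (mxvec_index i j).
have A0 i j : \sum_(s : 'S_n | s i == j) \prod_(l | l != i) A l (s l) = 0.
  have := xiP (map_mpoly g (per K n)^`M(mxvec_index i j)) (fun v Zv => Zv _).
  rewrite mmap_map_mpoly per_deriv rmorph_sum => E; rewrite -[RHS]E.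
  apply: eq_bigr => s _; rewrite rmorph_prod; apply: eq_bigr => l _ /=.
  by rewrite mmapX mmap1U.
have szA i : size [seq A i j | j <- enum 'I_n] = n by rewrite size_map size_enum_ord.
have := crit_boundP two_neq0 (m := n) (n := n).
rewrite n0 leqnn => /(_ isT F iota _ szA (fun i => omit1_of_permanents (A0 i))).
apply: codim_ge_mem; first by rewrite (size_flatten_enum szA) size_map size_enum_ord.
move=> _ /mapP[t _ ->]; case/mxvec_indexP: t => i j.
apply: (@mem_flatten_enum _ _ _ i).
by apply: (map_f (A i)); rewrite mem_enum.
Qed.

(** These are the free coordinates, outside the first two rows: [coord_space] annihilates the
    coordinates that are not in the set. *)
Definition zero_rows : {set 'I_(n * n)} :=
  [set mxvec_index x.1 x.2 | x in finset.setX [set i : 'I_n | (1 < i)%N] [set: 'I_n]]%SET.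

Lemma card_zero_rows : (1 < n)%N -> #|zero_rows| = (n * n - 2 * n)%N.
Proof.
move=> n1; rewrite card_in_imset => [|[i j] [i' j'] _ _ /= /mxvec_index_inj[-> ->]//].
rewrite cardsX cardsT card_ord -mulnBl; congr (_ * _)%N.
have := cardsC [set i : 'I_n | (1 < i)%N].
have -> : (~: [set i : 'I_n | (1 < i)%N] = [set Ordinal (ltnW n1); Ordinal n1])%SET.
  apply/setP => i; rewrite !inE -!val_eqE /= -leqNgt.
  by case: (val i) => [|[]].
by rewrite cards2 card_ord /= => nE; rewrite -[X in (X - 2)%N]nE addnK.
Qed.

Lemma zero_rows_sing : (1 < n)%N ->
  (coord_space zero_rows `<=` sing_locus g (per K n))%classic.
Proof.
move=> n1 v v0.
have row0 (l j : 'I_n) : (l <= 1)%N -> v 0 (mxvec_index l j) = 0.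
  move=> l1; apply: v0; apply/negP => /imsetP[[i' j']].
  rewrite !inE /= andbT => i1 /mxvec_index_inj[li _].
  by move: i1; rewrite -li ltnNge l1.
split=> [|t].
  rewrite meval_map_mpoly rmorph_sum big1 // => s _; rewrite rmorph_prod.
  rewrite (bigD1 (Ordinal n1)) //= mxE mmapX mmap1U row0 ?mul0r //.
case/mxvec_indexP: t => i j.
rewrite meval_map_mpoly per_deriv rmorph_sum big1 // => s _; rewrite rmorph_prod.
(* Deleting row [i] leaves at least one of the two zero rows. *)
have [l li l1] : exists2 l : 'I_n, l != i & (l <= 1)%N.
  have [->|i0] := eqVneq i (Ordinal (ltnW n1)).
    by exists (Ordinal n1).
  by exists (Ordinal (ltnW n1)) => //; rewrite eq_sym.
by rewrite (bigD1 l) //= mmapX mmap1U row0 ?mul0r.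
Qed.

(** Any [Z] between the two loci is treated at once: the singular locus contains the linear space
    that provides a long chain, and the critical locus bounds all chains. *)
Lemma has_codim_crit (Z : set 'rV[k]_(n * n)) :
  (1 < n)%N -> 2%:R != 0 :> k ->
  (sing_locus g (per K n) `<=` Z)%classic -> (Z `<=` crit_locus g (per K n))%classic ->
  has_codim Z (2 * n).
Proof.
move=> n1 two_neq0 singZ Zcrit; have n2 : (2 * n <= n * n)%N by rewrite leq_mul2r n1 orbT.
exists (n * n)%N, #|zero_rows|; split; first exact: has_dim_affine.
  apply: coord_space_has_dim; first by move=> v /(zero_rows_sing n1) /singZ.
  rewrite card_zero_rows // subKn // => F iota xi xiP.
  apply: crit_generic_codim_ge => //; first exact: ltnW.
  by move=> p pcrit; apply: xiP => v /Zcrit; apply: pcrit.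
by rewrite card_zero_rows // subnK.
Qed.

End CriticalLocus.

Theorem corollary1p2 (K : fieldType) (Kbar : closedFieldType)
    (iota : {rmorphism K -> Kbar}) (n : nat)
    (hKbar : is_algebraic_closure iota)
    (hchar : 2%N \notin [pchar K])
    (hn : (2 <= n)%N) :
  has_codim (crit_locus iota (per K n)) (2 * n) /\
  has_codim (sing_locus iota (per K n)) (2 * n).
Proof.
have two_neq0 : 2%:R != 0 :> Kbar.
  by rewrite -(rmorph_nat iota) fmorph_eq0; apply: contra hchar => K2; rewrite inE.
by split; apply: (has_codim_crit (g := iota)) => // v [].
Qed.
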